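(* Let $0 \le d \le n$ be integers and let $P \subset \mathbb{R}^n$ be a convex lattice polytope with $\dim P = d$. Then, as rational functions in $z$, \[ \mathrm{SE}(P^\circ;z) = \frac{(-1)^{d+1}}{1-z}\,\mathrm{Ehr}\!\left(P;\frac{1}{z}\right) = \frac{(-1)^{d}}{z}\,\mathrm{SE}\!\left(P;\frac{1}{z}\right). \]
   Context: A convex lattice polytope in $\mathbb{R}^n$ is the convex hull of a nonempty finite subset of $\mathbb{Z}^n$. $P^\circ$ is the relative interior of $P$. For an integer $t \ge 0$, $\mathcal E(P;t) := \#(tP \cap \mathbb{Z}^n)$, and $\mathrm{Ehr}(P;z) := \sum_{t=0}^\infty \mathcal E(P;t) z^t$. A horizontal giganture of $P$ is a polytope $G \subset \mathbb{R}^n$ such that $G = iP + a$ for some integer $i \ge 0$ and some $a \in \mathbb{Z}^n$ (for $i=0$ it is a single point). For an integer $t \ge 0$, $\mathcal H(P;t)$ is the number of horizontal gigantures of $P$ contained in $tP$. For an integer $t > 0$, $\mathcal H(P^\circ;t)$ is the number of horizontal gigantures of $P$ contained in $tP^\circ$. Put $\mathrm{SE}(P;z) := \sum_{t=0}^\infty \mathcal H(P;t) z^t$ and $\mathrm{SE}(P^\circ;z) := \sum_{t=1}^\infty \mathcal H(P^\circ;t) z^t$. These series and $\mathrm{Ehr}(P;z)$ are expansions at $z=0$ of rational functions, denoted by the same symbols; the substitution $z \mapsto 1/z$ is performed in these rational functions.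
   Formalization: The case d = 0 is excluded (0 < d ≤ n is assumed), because for P a single lattice point all the counts equal 1 and the three expressions are z/(1-z), z/(1-z)^2 and -1/(1-z), so the identity fails. *)

(* Defs.v *)
From HB Require Import structures.
From mathcomp Require Import all_boot all_order all_algebra finmap fraction.
From mathcomp Require Import generic_quotient.
From mathcomp Require Import all_classical all_reals topology normedtype convex.

Set Implicit Arguments.
Unset Strict Implicit.
Unset Printing Implicit Defensive.

Import Order.TTheory GRing.Theory Num.Theory.
Import numFieldNormedType.Exports.

Local Open Scope classical_set_scope.
Local Open Scope ring_scope.

Section Polytopes.
Variables (R : realType) (n : nat).
Implicit Types (A P G : set 'rV[R]_n) (a : 'rV[int]_n) (d i t : nat).

Definition lattice_vec a : 'rV[R]_n := map_mx intr a.

Definition conv_hull A : set 'rV[R]_n := smallest [set C | convex_set C] A.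

Definition lattice_polytope P : Prop :=
  exists S : set 'rV[int]_n,
    [/\ finite_set S, S !=set0 & P = conv_hull (lattice_vec @` S)].

Definition affine_hull A : set 'rV[R]_n :=
  [set y | exists (k : nat) (x : 'I_k -> 'rV[R]_n) (c : 'I_k -> R),
     [/\ forall j, A (x j), \sum_j c j = 1 & y = \sum_j c j *: x j]].

Definition has_dim A d : Prop :=
  exists (p : 'rV[R]_n) (U : {vspace 'rV[R]_n}),
    \dim U = d /\ affine_hull A = [set p + u | u in [set` U]].

(* The points outside [affine_hull A] are isolated in [subspace (affine_hull A)];
   this adds nothing to the interior since [A] is contained in its affine hull. *)
Definition relint A : set 'rV[R]_n :=
  interior (A : set (subspace (affine_hull A))).

Definition dilate t A : set 'rV[R]_n := [set t%:R *: x | x in A].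

Definition translate A a : set 'rV[R]_n := [set x + lattice_vec a | x in A].

Definition lattice_count P t : nat :=
  #|` fset_set [set a | dilate t P (lattice_vec a)]|.

Definition horizontal_giganture P G : Prop :=
  exists i a, G = translate (dilate i P) a.

(* Gigantures are counted as sets, not as pairs (i, a). If [P] is a single
   point, every giganture is a point, so exactly one is contained in each of
   [t P] and [t P°], and the reciprocity of the two counts fails. *)
Definition giganture_count P t : nat :=
  #|` fset_set [set G | horizontal_giganture P G /\ G `<=` dilate t P]|.

Definition giganture_count_relint P t : nat :=
  #|` fset_set [set G | horizontal_giganture P G /\ G `<=` dilate t (relint P)]|.

End Polytopes.

Notation ratfun := {fraction {poly rat}}.

Definition ratX : ratfun := tofrac 'X.

(* [f] is regular at 0 and its Taylor coefficients there are the [u k]: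
   [f = p / q] with [q(0) != 0] and [q * (sum_k u k z^k) = p]. *)
Definition is_expansion (f : ratfun) (u : nat -> rat) : Prop :=
  exists p q : {poly rat},
    [/\ q.[0] != 0, f = tofrac p / tofrac q &
        forall k : nat, \sum_(i < k.+1) q`_i * u (k - i)%N = p`_k].

(* The unique rational function with expansion [u] at 0 (and 0 if there is
   none). *)
Definition genfun (u : nat -> rat) : ratfun :=
  xget 0 [set f | is_expansion f u].

Definition poly_at_inv (p : {poly rat}) : ratfun :=
  (map_poly (fun c : rat => tofrac c%:P) p).[ratX^-1].

(* The substitution z := 1/z. The value does not depend on the representative,
   and the denominator is nonzero since 1/z is transcendental over the
   constants. *)
Definition subst_inv (f : ratfun) : ratfun :=
  let r := repr f in poly_at_inv \n_r / poly_at_inv \d_r.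

Section Series.
Variables (R : realType) (n : nat) (P : set 'rV[R]_n).

Definition ehr_coef (t : nat) : rat := (lattice_count P t)%:R.
Definition se_coef (t : nat) : rat := (giganture_count P t)%:R.
Definition se_relint_coef (t : nat) : rat :=
  if (0 < t)%N then (giganture_count_relint P t)%:R else 0.

Definition Ehr : ratfun := genfun ehr_coef.
Definition SE : ratfun := genfun se_coef.
Definition SE_relint : ratfun := genfun se_relint_coef.

End Series.

(* Main.v *)
(* A giganture i P + a lies in t P iff i <= t and a lies in (t - i) P, and
   likewise for the relative interiors, so both giganture counts are partial
   sums of lattice point counts and the theorem reduces to Ehrhart-Macdonald
   reciprocity.  The latter is obtained by placing P at height 1 and cutting
   the cone A over P into the simplicial cones B of a regular triangulation.
   For a generic vector w in the open cone, a point x lies in the closed cone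
   iff x + e w lies in exactly one B for all small e > 0, and in the open cone
   iff the same holds for x - e w.  This writes both cones as disjoint unions
   of half-open simplicial cones with complementary missing facets, and the
   lattice points of the two fundamental parallelepipeds over B are exchanged
   by x |-> (sum of the generators of B) - x. *)
From HB Require Import structures.
Require Import Defs.
From mathcomp Require Import all_boot all_order all_algebra finmap fraction.
From mathcomp Require Import generic_quotient.
From mathcomp Require Import all_classical all_reals topology normedtype convex.
From mathcomp Require Import interval_inference lra ring zify.

Set Implicit Arguments.
Unset Strict Implicit.
Unset Printing Implicit Defensive.

Import Order.TTheory GRing.Theory Num.Theory.
Import numFieldNormedType.Exports.
Local Open Scope ring_scope.

(** * Regular triangulations and half-open cones *)

(** The delicate half of the reduction is the converse: deducing [i <= t] and a in (t - i) P from i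
    P + a inside t P, without support functions. Writing each translated generator as a combination
    of the generators gives a nonnegative matrix with row sums t. Averaging these relations with a
    stationary vector of the matrix makes the same point of P appear on both sides, and cancellation
    leaves a = (t - i) times that point. The bound [i <= t] comes from a coordinate along which P
    has positive width, hence from d > 0. Counting functions live on all integers, multiplication by
    1 - z is a backward difference, and d + 1 differences turn every half-open cone into its
    parallelepiped; both numerators become finite sequences, each the reversal of the other. One
    positive weight vector [s] provides both the lifting heights of the triangulation and, as
    [s *m A], the generic interior direction. Small shifts are handled by lexicographic signs. *)

Section GenericVectors.
Variable R : realFieldType.

Lemma ex_generic_row (I : finType) m (F : I -> 'cV[R]_m) :
  exists s : 'rV[R]_m, (forall i, 0 < s 0 i) /\
    forall k, F k != 0 -> (s *m F k) 0 0 != 0.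
Proof.
(* Moment curve: the row [(1, x, x ^+ 2, ...)] times [F k] is the value at [x] of the polynomial
   with coefficients [F k]; finitely many nonzero polynomials have a common non-root among the
   positive integers. *)
pose p k := \poly_(i < m) (if insub i is Some j then F k j 0 else 0).
have pE k x : (p k).[x] = ((\row_i x ^+ i) *m F k) 0 0.
  rewrite horner_poly mxE; apply: eq_bigr => i _.
  by rewrite valK mxE mulrC.
have p0 k : F k != 0 -> p k != 0.
  apply: contraNneq => pk0; apply/eqP/colP => i; rewrite mxE.
  have := congr1 (fun q : {poly R} => q`_i) pk0.
  by rewrite coef_poly ltn_ord valK coef0.
pose P := \prod_(k | F k != 0) p k.
have P0 : P != 0 by apply/prodf_neq0 => k /p0.
pose rs : seq R := [seq i.+1%:R | i <- iota 0 (size P)].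
have : ~~ all (root P) rs.
  apply/negP => rsP; have := max_poly_roots P0 rsP.
  rewrite map_inj_uniq ?iota_uniq => [/(_ isT)|i j /eqP]; last first.
    by rewrite eqr_nat eqSS => /eqP.
  by rewrite size_map size_iota ltnn.
case/allPn => x /mapP[i _ xE] rootx.
exists (\row_i x ^+ i); split => [j|k Fk0].
  by rewrite mxE exprn_gt0 // xE ltr0n.
rewrite -pE; apply: contraNneq rootx => pkx.
by rewrite /root /P (bigD1 k) //= hornerM pkx mul0r.
Qed.

(** Positivity of [u + e * v] for all small [e > 0], stated without choosing [e]. *)
Definition lexpos (u v : R) := (0 < u) || (u == 0) && (0 < v).

(** This dichotomy is what makes the missing facets for [w] and [- w] complementary. *)
Lemma lexposN u v : v != 0 -> lexpos (- u) (- v) = ~~ lexpos u v.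
Proof. by rewrite /lexpos oppr_gt0 oppr_eq0 oppr_gt0; case: ltgtP; case: ltgtP. Qed.

Lemma lexposDl u v e : 0 <= e -> lexpos u v -> lexpos (u + e) v.
Proof.
rewrite le_eqVlt => /predU1P[<-|e_gt0]; first by rewrite addr0.
by rewrite /lexpos => /orP[u_gt0|/andP[/eqP-> _]]; rewrite ?add0r ?e_gt0 ?addr_gt0.
Qed.

Lemma ltr_bigmin (I : finType) (F : I -> R) :
  (forall k, 0 < F k) -> exists2 e : R, 0 < e & forall k, e < F k.
Proof.
move=> F0.
have F1 j : 0 < F j / (1 + F j) <= 1.
  by rewrite divr_gt0 ?addr_gt0 //= ler_pdivrMr ?addr_gt0 // mul1r lerDr.
(* Each factor is at most 1 and below its own [F k], so the product is below all of them. *)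
exists (\prod_k (F k / (1 + F k))) => [|k].
  by rewrite prodr_gt0 // => k _; case/andP: (F1 k).
rewrite (bigD1 k) //=.
apply: (@le_lt_trans _ _ (F k / (1 + F k))).
  apply: ler_piMr; first by rewrite ltW // (andP (F1 k)).1.
  by apply: prodr_ile1 => j _; have /andP[/ltW -> ->] := F1 j.
by rewrite ltr_pdivrMr ?addr_gt0 // ltr_pMr // ltrDl.
Qed.

Lemma lexpos_eps (I : finType) (u v : I -> R) :
  exists2 e : R, 0 < e & forall k, (0 < u k + e * v k) = lexpos (u k) (v k).
Proof.
(* Below this bound [e * v k] is smaller than [u k] in absolute value, so [u k] decides the sign;
   the 1 is a dummy for [u k = 0], where [v k] decides for every [e > 0]. *)
have [|e e0 eP] := @ltr_bigmin I (fun k => if u k == 0 then 1 else `|u k| / (1 + `|v k|)).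
  by move=> k; case: eqP => // /eqP uk0; rewrite divr_gt0 ?normr_gt0 // ltr_wpDr.
exists e => // k; rewrite /lexpos.
case: eqVneq (eP k) => [-> _|uk0 ek]; first by rewrite ltxx add0r pmulr_rgt0.
rewrite orbF; have {}ek : `|e * v k| < `|u k|.
  have v1 : 0 < 1 + `|v k| by rewrite ltr_wpDr.
  move: ek; rewrite ltr_pdivlMr // normrM (gtr0_norm e0); apply: le_lt_trans.
  by rewrite ler_pM2l // lerDr.
case: (ltgtP (u k) 0) uk0 => // [uk _|uk _].
  rewrite (ltr0_norm uk) in ek; apply/negbTE; rewrite -leNgt -lerBrDl sub0r.
  by rewrite (le_trans (ler_norm _)) // ltW.
rewrite (gtr0_norm uk) in ek; rewrite -ltrBlDr sub0r.
by rewrite (le_lt_trans _ ek) // -normrN ler_norm.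
Qed.

End GenericVectors.

(** * Bases among the generators and the regular triangulation *)

Section Triangulation.
Variables (R : realFieldType) (m N : nat) (A : 'M[R]_(m, N)).
Implicit Types (B D : {set 'I_m}) (c s : 'rV[R]_m) (y : 'rV[R]_N).

Definition set_mx D : 'M[R]_m := diag_mx (\row_i (i \in D)%:R).

Lemma mul_set_mx c D i : (c *m set_mx D) 0 i = if i \in D then c 0 i else 0.
Proof. by rewrite mul_mx_diag !mxE; case: ifP; rewrite ?mulr1 ?mulr0. Qed.

Lemma set_mx_id c D : (forall i, i \notin D -> c 0 i = 0) -> c *m set_mx D = c.
Proof. by move=> cD; apply/rowP => i; rewrite mul_set_mx; case: ifPn => // /cD. Qed.

Lemma set_mxK D : set_mx D *m set_mx D = set_mx D.
Proof.
apply/row_matrixP => i; rewrite row_mul set_mx_id // => j jD.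
by rewrite !mxE; case: eqP => // ->; rewrite (negPf jD).
Qed.

Definition spanning D := (A <= set_mx D *m A)%MS.

Definition independent D := forall c, c *m set_mx D = c -> c *m A = 0 -> c = 0.

Definition is_basis D := spanning D /\ independent D.

(** The right factor [set_mx D] forces the support into [D]. Being a matrix, it makes coordinates
    linear in the point for every [D], basis or not. *)
Definition coord_mx D : 'M[R]_(N, m) := pinvmx (set_mx D *m A) *m set_mx D.

Definition crd D y := y *m coord_mx D.

Lemma crdK D y : (y <= set_mx D *m A)%MS -> crd D y *m A = y.
Proof. by move=> yD; rewrite /crd /coord_mx mulmxA -mulmxA mulmxKpV. Qed.

Lemma crd_supp D y i : i \notin D -> crd D y 0 i = 0.
Proof. by move=> iD; rewrite /crd /coord_mx mulmxA mul_set_mx (negPf iD). Qed.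

Lemma crd_set_mx D y : crd D y *m set_mx D = crd D y.
Proof. by rewrite /crd /coord_mx -!mulmxA set_mxK. Qed.

Lemma crd_uniq D c : is_basis D -> c *m set_mx D = c -> crd D (c *m A) = c.
Proof.
move=> [_ indD] cD; apply/eqP; rewrite -subr_eq0; apply/eqP/indD.
  by rewrite mulmxBl crd_set_mx cD.
by rewrite mulmxBl crdK ?subrr // -cD -mulmxA submxMl.
Qed.

Lemma crd_delta D i : is_basis D -> i \in D -> crd D (row i A) = delta_mx 0 i.
Proof.
move=> bD iD; rewrite rowE crd_uniq // set_mx_id // => j jD.
by rewrite mxE /=; case: eqP jD => [->|]; rewrite ?iD.
Qed.

Definition in_cone y := exists2 c : 'rV[R]_m, (forall i, 0 <= c 0 i) & c *m A = y.

Lemma in_cone_submx y : in_cone y -> (y <= A)%MS.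
Proof. by case=> c _ <-; exact: submxMl. Qed.

Definition generic y := forall D, (y <= set_mx D *m A)%MS -> spanning D.

Lemma spanning_sub y D : spanning D -> (y <= A)%MS -> (y <= set_mx D *m A)%MS.
Proof. by move=> sD /submx_trans; apply. Qed.

(** Otherwise [y] would lie in the span of [D :\ i], which by genericity would then contain
    generator [i], against independence. *)
Lemma generic_crd_neq0 D y i :
  (y <= A)%MS -> generic y -> is_basis D -> i \in D -> crd D y 0 i != 0.
Proof.
move=> yA gy bD iD; apply: contraT; rewrite negbK => /eqP yi0.
have sD : spanning (D :\ i).
  apply: gy; rewrite -(crdK (spanning_sub bD.1 yA)).
  rewrite -[crd D y](@set_mx_id _ (D :\ i)); first by rewrite -mulmxA submxMl.
  move=> j; rewrite !inE negb_and negbK => /orP[/eqP->//|]; exact: crd_supp.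
have := crdK (spanning_sub sD (row_sub i A)).
set c := crd _ _ => cA; have := crd_delta bD iD.
rewrite -cA crd_uniq //; last first.
  rewrite set_mx_id // => j jD; rewrite /c crd_supp // !inE.
  by rewrite negb_and jD orbT.
move=> /(congr1 (fun c : 'rV_m => c 0 i)).
by rewrite /c crd_supp ?inE ?eqxx // mxE !eqxx => /eqP; rewrite eq_sym oner_eq0.
Qed.

(* The ratio test of the simplex algorithm. *)
Lemma ratio_test c (v : 'rV[R]_m) :
  (forall i, 0 <= c 0 i) -> (forall i, 0 < v 0 i -> 0 < c 0 i) ->
  (exists i, 0 < v 0 i) ->
  exists t k, [/\ 0 < t, 0 < v 0 k, (c - t *: v) 0 k = 0 &
    forall i, 0 <= (c - t *: v) 0 i].
Proof.
move=> c0 cv [i0 vi0].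
have [k vk kmin] := @arg_minP _ _ _ i0 (fun i => 0 < v 0 i)
  (fun i => c 0 i / v 0 i) vi0.
exists (c 0 k / v 0 k), k; split=> //.
- by rewrite divr_gt0 // cv.
- by rewrite !mxE mulfVK ?subrr // gt_eqF.
move=> i; rewrite !mxE subr_ge0; case: (ltP 0 (v 0 i)) => [vi|vi].
  by rewrite -ler_pdivlMr // kmin.
by rewrite (le_trans _ (c0 i)) // mulr_ge0_le0 // divr_ge0 // ltW // cv.
Qed.

Variable ht : 'cV[R]_N.
Hypothesis A_ht : A *m ht = const_mx 1.

Lemma sum_mul_ht c : (c *m A *m ht) 0 0 = \sum_i c 0 i.
Proof. by rewrite -mulmxA A_ht mxE; apply: eq_bigr => i _; rewrite mxE mulr1. Qed.

(** All generators have height 1, so the coefficients of a linear relation sum to 0. *)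
Lemma ker_pos c : c *m A = 0 -> c != 0 -> exists i, 0 < c 0 i.
Proof.
move=> cA cn0; apply: contrapT => /forallNP c_le0.
have {}c_le0 i : c 0 i <= 0 by rewrite leNgt; apply/negP/c_le0.
have := sum_mul_ht c; rewrite cA mul0mx mxE => /esym/eqP.
rewrite -oppr_eq0 -sumrN psumr_eq0 => [|i _]; last by rewrite oppr_ge0.
move=> /allP c0; case/eqP: cn0; apply/rowP => i; rewrite mxE.
by apply/eqP; rewrite -oppr_eq0; apply: (implyP (c0 i (mem_index_enum i))).
Qed.

(** The support of a representation of minimal support is a basis: it spans by genericity, and a
    relation on it would let the ratio test cancel one more coefficient. *)
Lemma Caratheodory y : in_cone y -> generic y ->
  exists2 B, is_basis B & forall i, 0 <= crd B y 0 i.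
Proof.
move=> [c0 c0_ge0 c0A] gy.
pose Q D := `[< exists c, [/\ (forall i, 0 <= c 0 i), c *m A = y & D = [set i | c 0 i != 0]] >].
have Q0 : Q [set i | c0 0 i != 0] by apply/asboolP; exists c0.
have [D /asboolP[c [c_ge0 cA DE]] Dmin] := arg_minnP (fun D : {set 'I_m} => #|D|) Q0.
have cD : c *m set_mx D = c.
  by apply: set_mx_id => i; rewrite DE inE negbK => /eqP.
have bD : is_basis D.
  split; first by apply: gy; rewrite -cA -cD -mulmxA submxMl.
  move=> v vD vA; apply/eqP; apply: contraT => vn0.
  have [i vi||t [k [_ vk ck c'ge0]]] := ratio_test c_ge0 (v := v); last 1 first.
  - have /Dmin : Q [set i | (c - t *: v) 0 i != 0].
      apply/asboolP; exists (c - t *: v); split=> //.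
      by rewrite mulmxBl -scalemxAl vA scaler0 subr0.
    rewrite leqNgt => /negP; case; apply: proper_card; apply/fintype.properP; split.
      apply/fintype.subsetP => i; rewrite inE; apply: contraR => iD.
      by rewrite !mxE -[c]cD -[v]vD !mul_set_mx (negPf iD) mulr0 subr0.
    exists k; last by rewrite inE ck eqxx.
    by rewrite -vD mul_set_mx in vk; case: ifP vk => //; rewrite ltxx.
  - rewrite lt0r c_ge0 andbT.
    rewrite -vD mul_set_mx in vi; case: ifP vi; last by rewrite ltxx.
    by rewrite DE inE.
  - exact: ker_pos.
by exists D => // i; rewrite -cA crd_uniq.
Qed.

Variable h : 'cV[R]_m.

Hypothesis h_gen : forall B a, is_basis B -> a \notin B ->
  (crd B (row a A) *m h) 0 0 != h a 0.

(** [crd B _ *m h] is the linear function that agrees with [h] on the generators in [B]. The cells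
    are thus the lower facets of the configuration lifted by [h]. *)
Definition triangulation B : Prop :=
  is_basis B /\ forall a, a \notin B -> (crd B (row a A) *m h) 0 0 < h a 0.

(** Simplex method: take a basis with nonnegative coordinates of [y] that minimises the interpolated
    height. A generator lifted below its linear function could be pivoted in, which would lower that
    height. *)
Lemma triangulation_cover y : in_cone y -> generic y ->
  exists2 B, triangulation B & forall i, i \in B -> 0 < crd B y 0 i.
Proof.
move=> yC gy; have yA := in_cone_submx yC.
pose Q D := `[< is_basis D /\ forall i, 0 <= crd D y 0 i >].
have [B0 bB0 B0_ge0] := Caratheodory yC gy.
have QB0 : Q B0 by apply/asboolP.
have [B /asboolP[bB B_ge0] Bmin] := arg_minP (fun D => (crd D y *m h) 0 0) QB0.
have B_gt0 i : i \in B -> 0 < crd B y 0 i.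
  by move=> iB; rewrite lt0r B_ge0 generic_crd_neq0.
exists B => //; split=> // a aB; rewrite lt_neqAle h_gen //= leNgt.
apply/negP => ha.
(* Subtracting [t *: v] brings in generator [a] with weight [t] and lowers the height, because [ha]
   makes [v *m h] positive. *)
pose v := crd B (row a A) - delta_mx 0 a.
have vA : v *m A = 0.
  by rewrite mulmxBl crdK ?spanning_sub ?bB.1 ?row_sub // -rowE subrr.
have vE i : v 0 i = crd B (row a A) 0 i - (i == a)%:R.
  by rewrite mxE [in X in _ + X]mxE [in X in _ - X]mxE.
have va : v 0 a = -1 by rewrite vE crd_supp // eqxx sub0r.
have vB i : i != a -> i \notin B -> v 0 i = 0.
  by move=> ia iB; rewrite vE crd_supp // (negPf ia) subrr.
have vpos i : 0 < v 0 i -> i \in B.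
  move=> vi; apply: contraT => iB; case: (eqVneq i a) vi => [->|ia].
    by rewrite va ltr0N1.
  by rewrite vB // ltxx.
have [i /vpos /B_gt0 //||t [k [t0 vk ck c_ge0]]] := ratio_test B_ge0 (v := v).
  apply: ker_pos => //; apply: contra_eqN va => /eqP->.
  by rewrite mxE eq_sym oppr_eq0 oner_eq0.
have kB := vpos _ vk.
set c := crd B y - t *: v in ck c_ge0.
have cA : c *m A = y.
  by rewrite mulmxBl -scalemxAl vA scaler0 subr0 crdK ?spanning_sub ?bB.1.
pose B' := a |: B :\ k.
have cB' : c *m set_mx B' = c.
  apply: set_mx_id => i; rewrite !inE !negb_or negb_and negbK.
  case/andP=> ia /orP[/eqP-> //|iB].
  by rewrite mxE crd_supp // add0r mxE [(_ *: v) _ _]mxE vB // mulr0 oppr0.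
have bB' : is_basis B'.
  split; first by apply: gy; rewrite -cA -cB' -mulmxA submxMl.
  move=> u uB' uA.
  (* Adding [u 0 a *: v] clears the entry at [a] and moves the relation into [B], where it must
     vanish; its entry at [k], which is outside [B'], then forces [u 0 a = 0]. *)
  have uv : u + u 0 a *: v = 0.
    apply: bB.2; last by rewrite mulmxDl uA -scalemxAl vA scaler0 addr0.
    apply: set_mx_id => i iB; rewrite mxE [(_ *: v) _ _]mxE.
    have [->|ia] := eqVneq i a; first by rewrite va mulrN1 subrr.
    rewrite vB // mulr0 addr0 -uB' mul_set_mx !inE (negPf ia) (negPf iB).
    by rewrite andbF.
  have uk : u 0 k = 0.
    rewrite -uB' mul_set_mx !inE eqxx orbF; case: eqP => // ka.
    by rewrite -ka kB in aB.
  have ua : u 0 a = 0.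
    have /rowP/(_ k) := uv; rewrite mxE uk add0r [(_ *: v) _ _]mxE [RHS]mxE => /eqP.
    by rewrite mulf_eq0 (gt_eqF vk) orbF => /eqP.
  by move: uv; rewrite ua scale0r addr0.
have crdB' : crd B' y = c by rewrite -cA crd_uniq.
have /Bmin : Q B' by apply/asboolP; split=> // i; rewrite crdB'.
rewrite crdB' leNgt => /negP; apply.
rewrite mulmxBl -scalemxAl mxE gtrDl mxE oppr_lt0 mxE pmulr_rgt0 //.
by rewrite mulmxBl mxE -rowE ![in X in 0 < _ + X]mxE subr_gt0.
Qed.

(** Write [y] with positive weights on [B']. The linear function of [B], given by [g] on the
    generators, is at most [h] there, with equality exactly on [B]. *)
Lemma triangulation_sub y B B' : (y <= A)%MS ->
  triangulation B -> triangulation B' ->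
  (forall i, i \in B' -> 0 < crd B' y 0 i) ->
  (crd B y *m h) 0 0 <= (crd B' y *m h) 0 0 ?= iff (B' \subset B).
Proof.
move=> yA [bB TB] [bB' _] B'pos.
pose g := A *m coord_mx B *m h.
have gE a : g a 0 = (crd B (row a A) *m h) 0 0.
  by rewrite /g /crd -!row_mul [RHS]mxE.
have -> : crd B y *m h = crd B' y *m g.
  rewrite /g mulmxA [_ *m (A *m _)]mulmxA crdK //.
  exact: spanning_sub bB'.1 yA.
have gB a : a \in B -> g a 0 = h a 0.
  by move=> aB; rewrite gE crd_delta // -rowE mxE.
rewrite !mxE; apply/leifP; case: (boolP (B' \subset B)) => [/fintype.subsetP B'B|].
  apply/eqP/eq_bigr => i _; case: (boolP (i \in B')) => iB'; last first.
    by rewrite crd_supp // !mul0r.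
  by rewrite gB ?B'B.
case/fintype.subsetPn => a aB' aB; rewrite (bigD1 a) //= [ltRHS](bigD1 a) //=.
rewrite ltr_leD //; first by rewrite ltr_pM2l ?B'pos // gE TB.
apply: ler_sum => i _; case: (boolP (i \in B')) => iB'; last first.
  by rewrite crd_supp // !mul0r.
rewrite ler_pM2l ?B'pos //; case: (boolP (i \in B)) => [/gB -> //|iB].
by rewrite ltW // gE TB.
Qed.

Lemma triangulation_uniq y B B' : (y <= A)%MS ->
  triangulation B -> triangulation B' ->
  (forall i, i \in B -> 0 < crd B y 0 i) ->
  (forall i, i \in B' -> 0 < crd B' y 0 i) -> B = B'.
Proof.
move=> yA TB TB' Bpos B'pos.
have h1 := triangulation_sub yA TB TB' B'pos.
have h2 := triangulation_sub yA TB' TB Bpos.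
have E : (crd B y *m h) 0 0 = (crd B' y *m h) 0 0.
  by apply/le_anti; rewrite h1 h2.
by apply/eqP; rewrite finset.eqEsubset -h1 -h2 E !eqxx.
Qed.

End Triangulation.

(** * Decomposition of the closed and the open cone into half-open simplicial cones *)

Section HalfOpenCones.
Variables (R : realFieldType) (m N : nat) (A : 'M[R]_(m, N)).
Implicit Types (B D : {set 'I_m}) (x w : 'rV[R]_N).

(** Both requirements say that finitely many linear forms do not vanish at [s]. Those of type [inl]
    test membership in a span through cokernels; those of type [inr] have entry -1 at [a], hence are
    nonzero even when generators repeat. *)
Lemma ex_generic_weights : exists s : 'rV[R]_m,
  [/\ forall i, 0 < s 0 i, generic A (s *m A) &
      forall B a, is_basis A B -> a \notin B ->
        (crd A B (row a A) *m s^T) 0 0 != s^T a 0].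
Proof.
pose F (k : {set 'I_m} * 'I_N + {set 'I_m} * 'I_m) : 'cV[R]_m :=
  match k with
  | inl Dk => col Dk.2 (A *m cokermx (set_mx R Dk.1 *m A))
  | inr Ba => (crd A Ba.1 (row Ba.2 A) - delta_mx 0 Ba.2)^T
  end.
have [s [s_gt0 sF]] := ex_generic_row F; exists s; split=> //.
  move=> D; rewrite submxE => /eqP sD; rewrite /spanning submxE.
  apply: contraT => /matrix0Pn[i [k ik]].
  have /sF : F (inl (D, k)) != 0.
    by apply: contraNneq ik => /(congr1 (fun c : 'cV_m => c i 0)); rewrite !mxE => ->.
  by rewrite /F colE mulmxA [s *m (_ *m _)]mulmxA sD mul0mx mxE eqxx.
move=> B a bB aB; have /sF : F (inr (B, a)) != 0.
  apply: contraTneq (oner_neq0 R) => /(congr1 (fun c : 'cV_m => c a 0)).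
  rewrite mxE mxE [in X in _ + X]mxE [in X in _ - X]mxE crd_supp // !eqxx mxE.
  by move=> /eqP; rewrite sub0r oppr_eq0 => ->.
have -> : (s *m F (inr (B, a))) 0 0 = (crd A B (row a A) *m s^T) 0 0 - s^T a 0.
  rewrite /F -[s in LHS]trmxK -trmx_mul mxE mulmxBl mxE -rowE /=.
  by rewrite [in X in _ + X]mxE [row _ _ _ _]mxE.
by rewrite subr_eq0.
Qed.

Lemma crdD B x w (e : R) i :
  crd A B (x + e *: w) 0 i = crd A B x 0 i + e * crd A B w 0 i.
Proof. by rewrite /crd mulmxDl -scalemxAl mxE [in X in _ + X]mxE. Qed.

Lemma crdN B w : crd A B (- w) = - crd A B w.
Proof. exact: mulNmx. Qed.

Lemma genericN w : generic A w -> generic A (- w).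
Proof. by move=> gw D; rewrite (eqmx_opp w); exact: gw. Qed.

(** The extra family [u], [v] lets callers impose further sign conditions on the same [e]. *)
Lemma generic_shift x w (I : finType) (u v : I -> R) : generic A w ->
  exists e, [/\ 0 < e, generic A (x + e *: w),
    forall B i, (0 < crd A B (x + e *: w) 0 i) =
                lexpos (crd A B x 0 i) (crd A B w 0 i) &
    forall k, (0 < u k + e * v k) = lexpos (u k) (v k)].
Proof.
move=> gw.
pose J : finType := ({set 'I_m} * 'I_m + {set 'I_m} * 'I_N * bool + I)%type.
pose E D : 'M[R]_N := cokermx (set_mx R D *m A).
(* Cokernel entries are listed with both signs: if one vanished at [x + e *: w], both tests would
   fail, whereas [lexposN] makes one succeed when the entry of [w] is nonzero. *)
pose F y (d : I -> R) (j : J) : R := match j with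
  | inl (inl Bi) => crd A Bi.1 y 0 Bi.2
  | inl (inr (D, k, b)) => (-1) ^+ b * (y *m E D) 0 k
  | inr i => d i end.
have [e e_gt0 eP] := lexpos_eps (F x u) (F w v).
exists e; split=> // [D|B i|k].
- rewrite submxE -/(E D) => /eqP/rowP xw; apply: gw.
  rewrite submxE -/(E D); apply: contraT => /rV0Pn[k wk].
  have xwk : (x *m E D) 0 k + e * (w *m E D) 0 k = 0.
    by have := xw k; rewrite mulmxDl -scalemxAl mxE [in X in _ + X]mxE [in RHS]mxE.
  have := eP (inl (inr (D, k, true))); have := eP (inl (inr (D, k, false))).
  rewrite /F /= !mul1r !mulN1r mulrN -opprD xwk oppr0 ltxx.
  by rewrite lexposN // => <-.
- by have := eP (inl (inl (B, i))); rewrite /F /= -crdD.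
by have := eP (inr k).
Qed.

(** [x + e *: w] is interior to the simplicial cone over [B] for small [e > 0]; the facet opposite
    to [b] is kept iff coordinate [b] of [w] is positive. *)
Definition half_open w B x :=
  (x <= A)%MS && [forall b in B, lexpos (crd A B x 0 b) (crd A B w 0 b)].

Variable ht : 'cV[R]_N.
Hypothesis A_ht : A *m ht = const_mx 1.
Variable s : 'rV[R]_m.
Hypothesis s_gt0 : forall i, 0 < s 0 i.
Hypothesis s_gen : forall B a, is_basis A B -> a \notin B ->
  (crd A B (row a A) *m s^T) 0 0 != s^T a 0.
Hypothesis sA_gen : generic A (s *m A).

Local Notation T := (triangulation A s^T).

Lemma half_open_uniq w B B' x : (w <= A)%MS -> generic A w -> T B -> T B' ->
  half_open w B x -> half_open w B' x -> B = B'.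
Proof.
move=> wA gw TB TB' /andP[xA /forall_inP xB] /andP[_ /forall_inP xB'].
have [e [e0 _ eP _]] := @generic_shift x w void (fun _ => 0) (fun _ => 0) gw.
apply: (@triangulation_uniq _ _ _ A s^T (x + e *: w)) => // [|i|i].
- by rewrite addmx_sub // scalemx_sub.
- by rewrite eP; exact: xB.
- by rewrite eP; exact: xB'.
Qed.

Lemma half_open_cover w x : (x <= A)%MS -> generic A w ->
  (exists2 e : R, 0 < e & forall d, 0 < d -> d < e -> in_cone A (x + d *: w)) ->
  exists2 B, T B & half_open w B x.
Proof.
move=> xA gw [e0 e0_gt0 xw].
(* The pair [e0], [-1] encodes the side condition [e < e0]. *)
have [e [e_gt0 xwg eP /(_ tt)]] := @generic_shift x w unit (fun=> e0) (fun=> -1) gw.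
rewrite mulrN1 subr_gt0 /lexpos e0_gt0 => /(xw _ e_gt0) xwC.
have [B TB Bpos] := triangulation_cover A_ht s_gen xwC xwg.
exists B => //; rewrite /half_open xA; apply/forall_inP => b /Bpos.
by rewrite eP.
Qed.

Lemma half_open_crd_ge0 w B x i : half_open w B x -> 0 <= crd A B x 0 i.
Proof.
case/andP=> _ /forall_inP xB; case: (boolP (i \in B)) => [/xB|/crd_supp->//].
by case/orP=> [/ltW //|/andP[/eqP->]].
Qed.

Lemma in_coneP x : in_cone A x <-> exists2 B, T B & half_open (s *m A) B x.
Proof.
split=> [xC|[B [bB _] xB]].
  apply: half_open_cover => //; first exact: in_cone_submx.
  case: xC => c c_ge0 <-; exists 1 => // d d0 _; exists (c + d *: s).
    by move=> i; rewrite !mxE addr_ge0 // mulr_ge0 ?ltW.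
  by rewrite mulmxDl -scalemxAl.
have xA : (x <= A)%MS by case/andP: xB.
exists (crd A B x); first by move=> i; exact: half_open_crd_ge0 xB.
by rewrite crdK // spanning_sub ?bB.1.
Qed.

Definition in_open_cone x := exists2 c : 'rV[R]_m, (forall i, 0 < c 0 i) & c *m A = x.

Lemma in_open_coneP x :
  in_open_cone x <-> exists2 B, T B & half_open (- (s *m A)) B x.
Proof.
split=> [[c c_gt0 cx]|[B [bB _] /andP[xA /forall_inP xB]]].
  apply: half_open_cover; first by rewrite -cx submxMl.
    exact: genericN.
  have [e [e0 _ _ eP]] := generic_shift 0 (fun i => c 0 i) (fun i => - s 0 i) sA_gen.
  exists e => // d d0 de; exists (c - d *: s); last first.
    by rewrite mulmxBl -scalemxAl scalerN cx.
  move=> i; have := eP i; rewrite /lexpos c_gt0 mulrN subr_gt0 /= => es.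
  by rewrite !mxE subr_ge0 ltW // (lt_trans _ es) // ltr_pM2r.
have [e [e0 _ eP _]] := @generic_shift x _ void (fun _ => 0) (fun _ => 0) (genericN sA_gen).
(* The shifted point is positive on [B]; adding [e *: s] recovers [x] and makes the coefficients off
   [B] positive as well. *)
exists (crd A B (x + e *: - (s *m A)) + e *: s).
  move=> i; rewrite mxE; case: (boolP (i \in B)) => iB.
    by rewrite addr_gt0 ?eP ?xB // mxE mulr_gt0.
  by rewrite crd_supp // add0r mxE mulr_gt0.
rewrite mulmxDl -scalemxAl crdK ?scalerN ?subrK // spanning_sub ?bB.1 //.
by rewrite addmx_sub // eqmx_opp scalemx_sub // submxMl.
Qed.

End HalfOpenCones.

(** * Lattice points in half-open cones *)

Local Open Scope classical_set_scope.

(** The common shape of the counts in the statement. It is 0 on infinite sets, so finiteness is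
    carried along below. *)
Definition card_set (T : choiceType) (X : set T) : nat := #|` fset_set X|.

Section Cardinality.
Variable T : choiceType.
Implicit Types X Y Z : set T.

Lemma card_set_image (U : choiceType) (f : T -> U) X :
  injective f -> finite_set X -> card_set (f @` X) = card_set X.
Proof.
move=> f_inj finX; rewrite /card_set fset_set_image // card_in_imfset //.
by move=> x y _ _; exact: f_inj.
Qed.

Lemma card_set_sum (I : finType) (P : pred I) (F : I -> set T) X : finite_set X ->
  (forall x, X x <-> exists2 i, P i & F i x) ->
  (forall x i j, P i -> P j -> F i x -> F j x -> i = j) ->
  card_set X = (\sum_(i | P i) card_set (F i))%N.
Proof.
move=> finX XF Funiq.
have E i : P i -> card_set (F i) = (\sum_(x <- fset_set X) (x \in F i))%N.
  move=> Pi.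
  have finF : finite_set (F i).
    by apply: sub_finite_set finX => x Fx; apply/XF; exists i.
  have -> : card_set (F i) = #|` [fset x in fset_set X | x \in F i]%fset|.
    rewrite /card_set; congr (#|` _|); apply/fsetP => x.
    rewrite !inE /= !in_fset_set //; apply/idP/andP => [/[dup] xF|[]//].
    by move/set_mem => Fx; split=> //; rewrite mem_set //; apply/XF; exists i.
  by rewrite card_fset_sum1 -big_fset_condE [LHS]big_mkcond.
rewrite (eq_bigr _ E) exchange_big /= /card_set card_fset_sum1.
rewrite big_seq [RHS]big_seq; apply: eq_bigr => x.
rewrite in_fset_set // => /set_mem /XF[i Pi Fi].
rewrite (bigD1 i) //= mem_set // big1 // => j /andP[Pj ji].
by rewrite memNset // => Fj; case/eqP: ji; apply: Funiq Fj Fi.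
Qed.

Lemma card_setU X Y Z : finite_set X -> (forall x, X x <-> Y x \/ Z x) ->
  (forall x, Y x -> ~ Z x) -> card_set X = (card_set Y + card_set Z)%N.
Proof.
move=> finX XYZ YZ.
rewrite (@card_set_sum bool predT (fun b => if b then Y else Z)) //.
- by rewrite big_bool.
- by move=> x; rewrite XYZ; split=> [[]|[[] _]]; [exists true|exists false|left|right].
by move=> x [] [] _ _ //= Fx Gx; [case: (YZ x)|case: (YZ x)].
Qed.

Lemma card_set0 X : (forall x, ~ X x) -> card_set X = 0%N.
Proof.
by move=> X0; rewrite (_ : X = set0) /card_set ?fset_set0 // -subset0 => x /X0.
Qed.

End Cardinality.

Lemma finite_int_box n (M : nat) :
  finite_set [set a : 'rV[int]_n | forall j, `|a 0 j| <= M%:Z].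
Proof.
pose f (b : 'rV['I_(M.*2.+1)]_n) : 'rV[int]_n := \row_j ((b 0 j : nat)%:Z - M%:Z).
apply: (@sub_finite_set _ _ (f @` [set: _])).
  move=> a aM; exists (\row_j inord `|(a 0 j + M%:Z)%R|%N) => //.
  apply/rowP => j; rewrite !mxE.
  have /ler_normlP := aM j; set x := a 0 j => -[xM1 xM2].
  rewrite inordK; last by lia.
  lia.
exact/finite_image/finite_finset.
Qed.

(** Multiplication by 1 - z on generating series; working over [int] avoids a separate case at
    [t = 0]. *)
Definition bdiff (V : zmodType) (u : int -> V) (t : int) : V := u t - u (t - 1).

Section LatticePoints.
Variables (R : realFieldType) (n m : nat) (S : 'M[int]_(m, n)).
Implicit Types (B J : {set 'I_m}) (t : int) (a : 'rV[int]_n).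

Definition point t a : 'rV[R]_(n + 1) := row_mx (map_mx intr a) (const_mx t%:~R).

Definition lift_mx : 'M[R]_(m, n + 1) := row_mx (map_mx intr S) (const_mx 1).

Definition height_cv : 'cV[R]_(n + 1) := col_mx 0 1.

Local Notation A := lift_mx.

Lemma lift_mx_height : A *m height_cv = const_mx 1.
Proof. by rewrite mul_row_col mulmx0 add0r mulmx1. Qed.

Lemma pointD t t' a b : point (t + t') (a + b) = point t a + point t' b.
Proof. by rewrite /point add_row_mx map_mxD; congr row_mx; apply/rowP => i; rewrite !mxE rmorphD. Qed.

Lemma pointB t t' a b : point (t - t') (a - b) = point t a - point t' b.
Proof. by rewrite -[in RHS](subrK t' t) -[in RHS](subrK b a) [in RHS]pointD addrK. Qed.

Lemma row_lift_mx i : row i A = point 1 (row i S).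
Proof. by rewrite row_row_mx; congr row_mx; apply/rowP => j; rewrite !mxE. Qed.

Lemma point_height t a : (point t a *m height_cv) 0 0 = t%:~R.
Proof. by rewrite mul_row_col mulmx0 add0r mulmx1 mxE. Qed.

Definition count_points (K : set 'rV[R]_(n + 1)) t : nat :=
  card_set [set a | K (point t a)].

Lemma sum_coef_point (c : 'rV[R]_m) t a : c *m A = point t a -> \sum_i c 0 i = t%:~R.
Proof. by move=> cA; rewrite -(sum_mul_ht lift_mx_height) cA point_height. Qed.

Lemma in_cone_height t a : in_cone A (point t a) -> 0 <= t.
Proof.
case=> c c_ge0 cA; rewrite -(ler0z R) -(sum_coef_point cA).
by apply: sumr_ge0 => i _.
Qed.

Lemma finite_cone t : finite_set [set a | in_cone A (point t a)].
Proof.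
(* The coefficients sum to [t], so any bound on the entries of [S], here their total absolute value,
   gives a box. *)
pose M : int := t * \sum_j \sum_i `|S i j|.
apply: (sub_finite_set _ (@finite_int_box n `|M|%N)).
move=> a /[dup] /in_cone_height t_ge0 [c c_ge0 cA] j.
rewrite abszE; apply: le_trans (ler_norm _); rewrite -(ler_int R) /M rmorphM /=.
rewrite -(sum_coef_point cA).
have -> : (`|a 0 j|)%:~R = `|(c *m A) 0 (lshift 1 j)|.
  by rewrite cA row_mxEl mxE intr_norm.
rewrite mxE (le_trans (ler_norm_sum _ _ _)) // mulr_suml ler_sum // => i _.
rewrite normrM (ger0_norm (c_ge0 i)) ler_wpM2l // row_mxEl mxE -intr_norm ler_int.
rewrite (bigD1 j) //= (bigD1 i) //= -addrA lerDl addr_ge0 ?sumr_ge0 // => k _.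
by rewrite sumr_ge0.
Qed.

Variable w : 'rV[R]_(n + 1).
Hypothesis w_gen : generic A w.
Hypothesis wA : (w <= A)%MS.

(* Points of the half-open cone over [B] whose coordinates along [J] are at
   most 1, with the complementary boundary conditions; for [J = B] this is the
   fundamental parallelepiped. *)
Definition half_open_box J B x :=
  half_open A w B x && [forall j in J, ~~ lexpos (crd A B x 0 j - 1) (crd A B w 0 j)].

Lemma half_open_in_cone B x : is_basis A B -> half_open A w B x -> in_cone A x.
Proof.
move=> bB xB; exists (crd A B x); first by move=> i; exact: half_open_crd_ge0 xB.
by rewrite crdK // spanning_sub ?bB.1 //; case/andP: xB.
Qed.

Lemma finite_half_open_box J B t : is_basis A B ->
  finite_set [set a | half_open_box J B (point t a)].
Proof.
move=> bB; apply: sub_finite_set (finite_cone t) => a /andP[aB _].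
exact: half_open_in_cone aB.
Qed.

Lemma crd_point_add B i t a : is_basis A B -> i \in B ->
  crd A B (point t (a + row i S)) = crd A B (point (t - 1) a) + delta_mx 0 i.
Proof.
by move=> bB iB; rewrite -{1}(subrK 1 t) pointD -row_lift_mx -(crd_delta bB iB) /crd mulmxDl.
Qed.

(** A point whose coordinate at [i] exceeds 1, ties being broken by [w], is generator [i] plus a
    point of the same box one level lower; the others form the box for [i |: J]. *)
Lemma count_half_open_boxS J B i t : is_basis A B -> i \in B -> i \notin J ->
  count_points (half_open_box J B) t =
  (count_points (half_open_box (i |: J) B) t +
   count_points (half_open_box J B) (t - 1))%N.
Proof.
move=> bB iB iJ; rewrite {3}/count_points.
rewrite -(@card_set_image _ _ (fun a => a + row i S)); last 2 first.
- exact: addIr.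
- exact: finite_half_open_box.
have xA t' a : (point t' (a + row i S) <= A)%MS = (point (t' - 1) a <= A)%MS.
  rewrite -{1}(subrK 1 t') pointD -row_lift_mx.
  apply/idP/idP => pA; last by rewrite addmx_sub // row_sub.
  by rewrite -[point _ a](addrK (row i A)) addmx_sub // eqmx_opp row_sub.
apply: card_setU => [|x|x]; first exact: finite_half_open_box.
- rewrite -[x](subrK (row i S)); set a := x - row i S => /=.
  rewrite /half_open_box /half_open xA.
  rewrite crd_point_add //; set c := crd A B (point _ a).
  have cE j : (c + delta_mx 0 i) 0 j = c 0 j + (j == i)%:R by rewrite mxE [in X in _ + X]mxE.
  split.
    move=> /andP[/andP[aA /forall_inP lo] /forall_inP up].
    case: (boolP (lexpos (c 0 i) (crd A B w 0 i))) => ci.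
      right; exists a => //; rewrite /half_open_box /half_open aA -/c /=.
      apply/andP; split; apply/forall_inP => j jP.
        have [->//|ji] := eqVneq j i.
        by have := lo _ jP; rewrite cE (negPf ji) addr0.
      have ji : j != i by apply: contraNneq iJ => <-.
      by have := up _ jP; rewrite cE (negPf ji) addr0.
    left; rewrite aA /=; apply/andP; split; apply/forall_inP => j; first exact: lo.
    by rewrite !inE => /orP[/eqP->|]; [rewrite cE eqxx addrK|exact: up].
  move=> [/andP[lo /forall_inP up]|[b + /addIr ba]].
    by rewrite lo; apply/forall_inP => j jJ; apply: up; rewrite !inE jJ orbT.
  rewrite ba => /andP[/andP[aA /forall_inP lo] /forall_inP up]; rewrite aA /=.
  apply/andP; split; apply/forall_inP => j jP.
    by rewrite cE lexposDl ?ler0n ?lo.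
  have ji : j != i by apply: contraNneq iJ => <-.
  by have := up _ jP; rewrite cE (negPf ji) addr0.
move=> /andP[_ /forall_inP up] [a /andP[/andP[_ /forall_inP lo] _] xE].
have := up i (finset.setU11 _ _); rewrite -xE crd_point_add // mxE [in X in _ + X - _]mxE.
by rewrite !eqxx addrK lo.
Qed.

(** Each difference bounds one more coordinate, until the parallelepiped is left. *)
Lemma bdiff_half_open B t : is_basis A B ->
  iter #|B| (@bdiff rat) (fun t => (count_points (half_open A w B) t)%:R) t =
  (count_points (half_open_box B B) t)%:R.
Proof.
move=> bB.
suff H k : forall J, J \subset B -> #|J| = k -> forall t,
    iter k (@bdiff rat) (fun t => (count_points (half_open A w B) t)%:R) t =
    (count_points (half_open_box J B) t)%:R by exact: (H _ B).
elim: k => [|k IH] J JB Jk {}t.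
  congr (card_set _)%:R; apply/seteqP; split=> a /=; last by case/andP.
  rewrite /half_open_box (finset.cards0_eq Jk) => ->.
  by apply/forall_inP => j; rewrite inE.
have [i iJ] : exists i, i \in J by apply/card_gt0P; rewrite Jk.
have JiB : J :\ i \subset B by exact: fintype.subset_trans (finset.subsetDl _ _) JB.
have Jik : #|J :\ i| = k by move: Jk; rewrite (finset.cardsD1 i) iJ => -[].
rewrite iterS {1}/bdiff !(IH (J :\ i)) // (@count_half_open_boxS _ _ i) ?finset.setD11 //.
  by rewrite finset.setD1K // natrD addrK.
exact: (fintype.subsetP JB).
Qed.

End LatticePoints.

(** Ensures that one power of 1 - z serves all cells at once. *)
Lemma card_basis (R : realFieldType) m N (A : 'M[R]_(m, N)) B :
  is_basis A B -> #|B| = \rank A.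
Proof.
move=> [sB iB]; pose f : 'I_#|B| -> 'I_m := enum_val.
have /eqP <- : row_free (rowsub f A).
  apply: inj_row_free => v; rewrite -[A in rowsub _ A]mul1mx -mul_rowsub_mx mulmxA.
  set c := v *m _ => cA.
  have cE i : c 0 i = \sum_k v 0 k * (f k == i)%:R.
    by rewrite mxE; apply: eq_bigr => k _; rewrite !mxE.
  have /rowP c0 : c = 0.
    apply: iB cA; apply: set_mx_id => i iB; rewrite cE big1 // => k _.
    by case: eqP iB => [<-|]; rewrite ?mulr0 ?enum_valP.
  apply/rowP => k; have := c0 (f k).
  rewrite cE (bigD1 k) //= eqxx mulr1 big1 ?addr0 ?mxE // => l lk.
  by rewrite (inj_eq enum_val_inj) (negPf lk) mulr0.
apply/eqP; rewrite eqn_leq; apply/andP; split; apply: mxrankS.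
  by apply/row_subP => k; rewrite row_rowsub row_sub.
apply: submx_trans sB _; apply/row_subP => i; rewrite row_mul.
case: (boolP (i \in B)) => iB'.
  have -> : row i (set_mx R B) = delta_mx 0 i.
    by apply/rowP => j; rewrite !mxE iB' eq_sym.
  by rewrite -rowE -(enum_rankK_in iB' iB') -/(f _) -row_rowsub row_sub.
rewrite (_ : row i _ = 0) ?mul0mx ?sub0mx //.
by apply/rowP => j; rewrite !mxE (negPf iB') mul0rn.
Qed.

(** * Exchange of the parallelepipeds and reciprocity for the cone *)

Section Reciprocity.
Variables (R : realFieldType) (n m : nat) (S : 'M[int]_(m, n)).
Implicit Types (B : {set 'I_m}) (t : int) (a : 'rV[int]_n).
Local Notation A := (lift_mx R S).

Definition basis_sum B : 'rV[int]_n := (\row_i (i \in B)%:R) *m S.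

Lemma point_basis_sum B :
  point R #|B|%:Z (basis_sum B) = (\row_i (i \in B)%:R) *m A.
Proof.
rewrite mul_mx_row /point map_mxM; congr row_mx.
  by congr (_ *m _); apply/rowP => i; rewrite !mxE rmorph_nat.
apply/rowP => i; rewrite !mxE -pmulrn -sum1_card natr_sum big_mkcond /=.
by apply: eq_bigr => j _; rewrite !mxE mulr1; case: (j \in B).
Qed.

Lemma crd_point_basis_sum B i : is_basis A B -> i \in B ->
  crd A B (point R #|B|%:Z (basis_sum B)) 0 i = 1.
Proof.
move=> bB iB; rewrite point_basis_sum crd_uniq ?mxE ?iB //.
by apply: set_mx_id => j jB; rewrite mxE (negPf jB).
Qed.

Lemma half_open_box_compl (w : 'rV[R]_(n + 1)) B x :
  generic A w -> (w <= A)%MS -> is_basis A B -> half_open_box S w B B x ->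
  half_open_box S (- w) B B (point R #|B|%:Z (basis_sum B) - x).
Proof.
move=> gw wA bB /andP[/andP[xA /forall_inP lo] /forall_inP up].
have crdE j : j \in B ->
    crd A B (point R #|B|%:Z (basis_sum B) - x) 0 j = 1 - crd A B x 0 j.
  move=> jB; rewrite -(crd_point_basis_sum bB jB) /crd mulmxBl.
  by rewrite mxE [in X in _ + X]mxE.
have wE j : crd A B (- w) 0 j = - crd A B w 0 j by rewrite crdN mxE.
rewrite /half_open_box /half_open addmx_sub ?eqmx_opp ?point_basis_sum ?submxMl //=.
rewrite -point_basis_sum; apply/andP.
split; apply/forall_inP => j jB; rewrite crdE // wE.
  (* Under c -> 1 - c the lower and upper conditions trade places; genericity supplies the nonzero
     second argument of [lexposN]. *)
  by rewrite -opprB lexposN ?up ?generic_crd_neq0.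
by rewrite addrC addKr lexposN ?negbK ?lo ?generic_crd_neq0.
Qed.

Lemma count_half_open_box_compl (w : 'rV[R]_(n + 1)) B t :
  generic A w -> (w <= A)%MS -> is_basis A B ->
  count_points (half_open_box S (- w) B B) t =
  count_points (half_open_box S w B B) (#|B|%:Z - t).
Proof.
move=> gw wA bB; rewrite [RHS]/count_points.
rewrite -(@card_set_image _ _ (fun a => basis_sum B - a)); last 2 first.
- by move=> a b /addrI/oppr_inj.
- exact: finite_half_open_box.
congr card_set; apply/seteqP; split=> a /= aB.
  exists (basis_sum B - a); last by rewrite opprB addrC subrK.
  rewrite pointB -[w]opprK; apply: half_open_box_compl => //.
    exact: genericN.
  by rewrite eqmx_opp.
case: aB => b bB' <-; rewrite -[t in point _ t](subKr #|B|%:Z) pointB.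
exact: half_open_box_compl.
Qed.

Lemma count_half_open_box_lt0 (w : 'rV[R]_(n + 1)) B t : is_basis A B ->
  t < 0 -> count_points (half_open_box S w B B) t = 0%N.
Proof.
move=> bB t0; apply: card_set0 => a /= /andP[/(half_open_in_cone bB) xC _].
by have := in_cone_height xC; rewrite leNgt t0.
Qed.

Lemma iter_bdiff_sum (V : zmodType) (I : finType) (P : pred I) (F : I -> int -> V) k t :
  iter k (@bdiff V) (fun t => \sum_(i | P i) F i t) t =
  \sum_(i | P i) iter k (@bdiff V) (F i) t.
Proof.
elim: k t => //= k IH t.
by rewrite /bdiff !IH -sumrB.
Qed.

Lemma count_points_half_open (w : 'rV[R]_(n + 1)) (K : set 'rV[R]_(n + 1))
    (T : {set 'I_m} -> Prop) t :
  (w <= A)%MS -> generic A w -> (forall B, T B -> is_basis A B) ->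
  (forall x B B', T B -> T B' -> half_open A w B x -> half_open A w B' x -> B = B') ->
  (forall x, K x <-> exists2 B, T B & half_open A w B x) ->
  iter (\rank A) (@bdiff rat) (fun t => (count_points K t)%:R) t =
  \sum_(B | `[< T B >]) (count_points (half_open_box S w B B) t)%:R.
Proof.
move=> wA gw Tbasis Tuniq KE.
have E : (fun t => (count_points K t)%:R : rat) =
    (fun t => \sum_(B | `[< T B >]) (count_points (half_open A w B) t)%:R).
  apply/funext => t'; rewrite -natr_sum; congr (_%:R); apply: card_set_sum.
  - apply: sub_finite_set (finite_cone R S t') => a /KE[B /Tbasis TB].
    exact: half_open_in_cone.
  - move=> a; rewrite /= KE; split=> -[B TB xB]; exists B => //; exact/asboolP.
  by move=> a B B' /asboolP TB /asboolP TB'; exact: Tuniq.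
rewrite E iter_bdiff_sum; apply: eq_bigr => B /asboolP TB.
by rewrite -(card_basis (Tbasis _ TB)) bdiff_half_open //; exact: Tbasis.
Qed.

(** [g] is the h*-vector, extended by 0 to all integers: its values count the lattice points of the
    parallelepipeds by height. *)
Theorem cone_reciprocity : exists g : int -> rat,
  [/\ forall t, iter (\rank A) (@bdiff rat)
                  (fun t => (count_points (in_cone A) t)%:R) t = g t,
      forall t, iter (\rank A) (@bdiff rat)
                  (fun t => (count_points (in_open_cone A) t)%:R) t =
                g ((\rank A)%:Z - t) &
      forall t, t < 0 \/ (\rank A)%:Z < t -> g t = 0].
Proof.
have [s [s_gt0 gw hs]] := ex_generic_weights A.
set w := s *m A in gw; have wA : (w <= A)%MS by exact: submxMl.
have gwN := genericN gw; have wNA : (- w <= A)%MS by rewrite eqmx_opp.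
pose T := triangulation A s^T.
have Tbasis B : T B -> is_basis A B by case.
exists (fun t => \sum_(B | `[< T B >]) (count_points (half_open_box S w B B) t)%:R).
split=> t.
- apply: count_points_half_open => //.
    by move=> x B B'; exact: half_open_uniq.
  by move=> x; exact: (in_coneP (lift_mx_height R S)).
- rewrite (@count_points_half_open (- w) _ T) //.
  + apply: eq_bigr => B /asboolP/Tbasis bB.
    by rewrite (count_half_open_box_compl _ gw wA bB) (card_basis bB).
  + by move=> x B B'; exact: half_open_uniq.
  by move=> x; exact: (in_open_coneP (lift_mx_height R S)).
move=> ht; apply: big1 => B /asboolP/Tbasis bB; apply/eqP; rewrite pnatr_eq0; apply/eqP.
case: ht => [|ht]; first exact: count_half_open_box_lt0.
rewrite -(subKr #|B|%:Z t) -count_half_open_box_compl //.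
by rewrite count_half_open_box_lt0 // subr_lt0 (card_basis bB).
Qed.

End Reciprocity.

(** * Rational generating functions *)

Definition convolution (p : {poly rat}) (u : nat -> rat) (k : nat) : rat :=
  \sum_(i < k.+1) p`_i * u (k - i)%N.

(** Coefficient [k] sees only a truncation of the series, so identities of power series are
    inherited from polynomials. *)
Lemma convolution_coef p u k K : (k <= K)%N ->
  convolution p u k = (p * \poly_(i < K.+1) u i)`_k.
Proof.
move=> kK; rewrite coefM; apply: eq_bigr => i _.
by rewrite coef_poly ltnS (leq_trans (leq_subr _ _)).
Qed.

Lemma convolutionM p q u k : convolution (p * q) u k = convolution p (convolution q u) k.
Proof.
rewrite (convolution_coef _ _ (leqnn k)) -mulrA coefM; apply: eq_bigr => i _.
by rewrite (@convolution_coef _ _ _ k) // leq_subr.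
Qed.

Lemma convolution_ext p u v : u =1 v -> convolution p u =1 convolution p v.
Proof. by move=> uv k; apply: eq_bigr => i _; rewrite uv. Qed.

Lemma convolution1 u k : convolution 1 u k = u k.
Proof. by rewrite (convolution_coef _ _ (leqnn k)) mul1r coef_poly leqnn. Qed.

Lemma convolution_1subX u k :
  convolution (1 - 'X) u k = u k - (if k is k'.+1 then u k' else 0).
Proof.
rewrite (convolution_coef _ _ (leqnn k)) mulrBl mul1r coefB coefXM !coef_poly leqnn.
by case: k => //= k; rewrite ltnS leqW.
Qed.

(** Vanishing at negative arguments makes the two agree at [k = 0], where the difference refers to
    [-1]. *)
Lemma convolution_bdiff r (U : int -> rat) k : (forall t, t < 0 -> U t = 0) ->
  convolution ((1 - 'X) ^+ r) (fun k => U k%:Z) k = iter r (@bdiff rat) U k%:Z.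
Proof.
move=> U0.
have itU0 : forall r t, t < 0 -> iter r (@bdiff rat) U t = 0.
  elim=> //= r' IH t t0; rewrite /bdiff !IH ?subrr //.
  by rewrite (lt_trans _ t0) // ltrBlDr ltrDl.
elim: r k => [|r IH] k; first by rewrite expr0 convolution1.
rewrite exprS convolutionM convolution_1subX /= /bdiff IH; congr (_ - _).
case: k => [|k]; first by rewrite itU0.
by rewrite IH; congr (iter _ _ _ _); rewrite intS addrC addKr.
Qed.

(** Both [p1 * q2] and [p2 * q1] are the series [u] multiplied by [q1 * q2]. *)
Lemma is_expansion_uniq f g u : is_expansion f u -> is_expansion g u -> f = g.
Proof.
move=> [p1 [q1 [q10 -> E1]]] [p2 [q2 [q20 -> E2]]].
have nz (q : {poly rat}) : q.[0] != 0 -> tofrac q != 0.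
  by rewrite tofrac_eq0; apply: contra_neq => ->; rewrite horner0.
apply/eqP; rewrite eqr_div ?nz // -!tofracM tofrac_eq; apply/eqP/polyP => k.
have C (p q : {poly rat}) : (forall k, convolution q u k = p`_k) ->
    forall (q' : {poly rat}) k, (q' * p)`_k = convolution (q' * q) u k.
  move=> E q' j; rewrite convolutionM coefM; apply: eq_bigr => i _.
  by rewrite E.
by rewrite mulrC (C _ _ E1) [p2 * q1]mulrC (C _ _ E2) mulrC.
Qed.

Lemma genfunE f u : is_expansion f u -> genfun u = f.
Proof.
move=> fu; apply: (is_expansion_uniq _ fu); rewrite /genfun.
by case: xgetP => [g -> //|/(_ f)].
Qed.

Definition const_ratfun (c : rat) : ratfun := tofrac c%:P.

HB.instance Definition _ := GRing.RMorphism.copy const_ratfun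
  (@FracField.tofrac _ \o (polyC : rat -> {poly rat})).

Lemma poly_at_invE p : poly_at_inv p = (map_poly const_ratfun p).[ratX^-1].
Proof. by []. Qed.

Lemma poly_at_invM p q : poly_at_inv (p * q) = poly_at_inv p * poly_at_inv q.
Proof. by rewrite !poly_at_invE rmorphM hornerM. Qed.

Lemma poly_at_invXn p k : poly_at_inv (p ^+ k) = poly_at_inv p ^+ k.
Proof. by rewrite !poly_at_invE rmorphXn horner_exp. Qed.

Lemma ratX_neq0 : ratX != 0.
Proof. by rewrite /ratX tofrac_eq0 polyX_eq0. Qed.

Lemma poly_at_inv_1subX : poly_at_inv (1 - 'X) = - (1 - ratX) / ratX.
Proof.
rewrite poly_at_invE rmorphB /= map_polyX rmorph1 !hornerE opprB mulrBl.
by rewrite mulfV ?ratX_neq0 // mul1r.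
Qed.

(** Reversal is taken at the prescribed degree [e], so vanishing top coefficients do no harm. *)
Lemma poly_at_inv_rev e (p : {poly rat}) : (size p <= e.+1)%N ->
  poly_at_inv p = tofrac (\poly_(i < e.+1) p`_(e - i)) / ratX ^+ e.
Proof.
move=> pe; apply: (canRL (mulfK _)); first by rewrite expf_neq0 ?ratX_neq0.
rewrite poly_at_invE (horner_coef_wide _ (n := e.+1)); last first.
  by rewrite size_map_poly.
rewrite mulr_suml poly_def rmorph_sum /= (reindex_inj rev_ord_inj) /=.
apply: eq_bigr => i _; rewrite subSS coef_map /= -mul_polyC rmorphM rmorphXn /= -/ratX.
rewrite -/(const_ratfun _) -mulrA; congr (_ * _).
have ie : (i <= e)%N by rewrite -ltnS.
rewrite -[X in _ * ratX ^+ X](subnK ie) exprD exprVn mulKf // expf_neq0 //.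
exact: ratX_neq0.
Qed.

Lemma poly_at_inv_neq0 (p : {poly rat}) : p != 0 -> poly_at_inv p != 0.
Proof.
move=> p0; have sp : (size p).-1.+1 = size p by rewrite prednK // size_poly_gt0.
rewrite (@poly_at_inv_rev (size p).-1) ?sp //.
apply: mulf_neq0; last exact/invr_neq0/expf_neq0/ratX_neq0.
rewrite tofrac_eq0.
apply: contra_neq p0 => /(congr1 (fun q : {poly rat} => q`_0)).
rewrite coef_poly size_poly_gt0 subn0 coef0; case: eqP => //= _.
by move/eqP; rewrite lead_coef_eq0 => /eqP.
Qed.

Lemma subst_invE (p q : {poly rat}) : q != 0 ->
  subst_inv (tofrac p / tofrac q) = poly_at_inv p / poly_at_inv q.
Proof.
move=> q0; rewrite /subst_inv; set f := tofrac p / _; set r := repr f.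
have r0 : \d_r != 0 by exact: denom_ratioP.
have fE : f = tofrac \n_r / tofrac \d_r.
  rewrite -[f]reprK -/r; unlock FracField.tofrac.
  rewrite -[X in _ = _ * X]FracField.pi_inv -[RHS]FracField.pi_mul.
  rewrite /FracField.mulf /FracField.invf !numden_Ratio ?oner_neq0 //.
  by rewrite mulr1 mul1r Ratio_numden.
apply/eqP; rewrite eqr_div ?poly_at_inv_neq0 // -!poly_at_invM.
move/eqP: fE; rewrite /f eqr_div ?tofrac_eq0 // -!tofracM tofrac_eq => /eqP E.
by rewrite E.
Qed.

(** [M] is the reversed numerator, [M / x ^+ d.+1] the numerator at 1/x, and [- (1 - x) / x] is 1 -
    1/x, whose powers produce the signs. *)
Lemma reciprocity_identity (F : fieldType) (x M : F) d : x != 0 -> 1 - x != 0 ->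
  M / (1 - x) ^+ d.+2 =
    (-1) ^+ d.+1 / (1 - x) * (M / x ^+ d.+1 / (- (1 - x) / x) ^+ d.+1) /\
  (-1) ^+ d.+1 / (1 - x) * (M / x ^+ d.+1 / (- (1 - x) / x) ^+ d.+1) =
    (-1) ^+ d / x * (M / x ^+ d.+1 / (- (1 - x) / x) ^+ d.+2).
Proof.
move=> x0 y0.
have E k : (- (1 - x) / x) ^+ k = (-1) ^+ k * (1 - x) ^+ k / x ^+ k.
  by rewrite exprMn exprVn [in LHS]exprNn.
rewrite !{}E; have xd0 := expf_neq0 d x0; have yd0 := expf_neq0 d y0.
rewrite !exprS; have := sqrr_sign F d; have := signr_eq0 F d.
set s := (-1) ^+ d; set xd := x ^+ d in xd0 *; set yd := (1 - x) ^+ d in yd0 *.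
move: xd yd (1 - x) y0 xd0 yd0 => xd yd y y0 xd0 yd0 /negbT s0 s2.
by split; field; rewrite x0 y0 s0 xd0 yd0 oppr_eq0 oner_eq0.
Qed.

(** [e] and [o] will be the counts for the closed and the open cone, [se] and [so] their partial
    sums, which cost one more factor [1 - 'X] in the denominator. *)
Theorem series_reciprocity d (g e o se so : nat -> rat) :
  (forall k, convolution ((1 - 'X) ^+ d.+1) e k = if (k <= d.+1)%N then g k else 0) ->
  (forall k, convolution ((1 - 'X) ^+ d.+1) o k = if (k <= d.+1)%N then g (d.+1 - k)%N else 0) ->
  convolution (1 - 'X) se =1 e -> convolution (1 - 'X) so =1 o ->
  [/\ is_expansion (genfun e) e, is_expansion (genfun se) se & is_expansion (genfun so) so]
  /\ genfun so = (-1) ^+ d.+1 / (1 - ratX) * subst_inv (genfun e)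
  /\ (-1) ^+ d.+1 / (1 - ratX) * subst_inv (genfun e)
     = (-1) ^+ d / ratX * subst_inv (genfun se).
Proof.
move=> eg og se_e so_o.
pose N := \poly_(i < d.+2) g i; pose N' := \poly_(i < d.+2) g (d.+1 - i)%N.
have oneX0 k : ((1 - 'X : {poly rat}) ^+ k).[0] != 0.
  by rewrite horner_exp !hornerE expr1n oner_neq0.
have oneXn0 k : (1 - 'X : {poly rat}) ^+ k != 0.
  by apply: contra_neq (oneX0 k) => ->; rewrite horner0.
have expE : is_expansion (tofrac N / tofrac ((1 - 'X) ^+ d.+1)) e.
  by exists N, ((1 - 'X) ^+ d.+1); split=> // k; rewrite [LHS]eg coef_poly ltnS.
have expSE : is_expansion (tofrac N / tofrac ((1 - 'X) ^+ d.+2)) se.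
  exists N, ((1 - 'X) ^+ d.+2); split=> // k.
  rewrite exprSr -/(convolution _ _ _) convolutionM (convolution_ext _ se_e).
  by rewrite eg coef_poly ltnS.
have expSO : is_expansion (tofrac N' / tofrac ((1 - 'X) ^+ d.+2)) so.
  exists N', ((1 - 'X) ^+ d.+2); split=> // k.
  rewrite exprSr -/(convolution _ _ _) convolutionM (convolution_ext _ so_o).
  by rewrite og coef_poly ltnS.
rewrite (genfunE expE) (genfunE expSE) (genfunE expSO); split=> //.
rewrite !subst_invE ?oneXn0 //; rewrite !poly_at_invXn poly_at_inv_1subX.
rewrite (@poly_at_inv_rev d.+1); last exact: size_poly.
rewrite (_ : \poly_(i < _) N`_(_ - i) = N'); last first.
  by apply/polyP => i; rewrite !coef_poly; case: ifP => // _; rewrite ltnS leq_subr.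
have -> : tofrac ((1 - 'X) ^+ d.+2) = (1 - ratX) ^+ d.+2 :> ratfun.
  by rewrite rmorphXn rmorphB rmorph1.
have X0 := ratX_neq0.
have Y0 : 1 - ratX != 0.
  by have := oneXn0 1; rewrite expr1 -tofrac_eq0 rmorphB rmorph1.
move: ratX X0 Y0 (tofrac N') => x x0 x1 M.
exact (reciprocity_identity M d x0 x1).
Qed.

(** * Polytopes and shifted dilates *)

Section Geometry.
Variables (R : realType) (n m : nat) (S : 'M[int]_(m, n)).
Hypothesis m_gt0 : (0 < m)%N.
Implicit Types (t : R) (x y : 'rV[R]_n) (c : 'rV[R]_m).

Local Notation A := (lift_mx R S).
Local Notation V := (map_mx intr S : 'M[R]_(m, n)).

Definition at_height t x : 'rV[R]_(n + 1) := row_mx x (const_mx t).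

Definition lattice_hull : set 'rV[R]_n := conv_hull (range (fun i => row i V)).

Local Notation P := lattice_hull.

Lemma at_heightD t u x y : at_height (t + u) (x + y) = at_height t x + at_height u y.
Proof. by rewrite /at_height add_row_mx; congr row_mx; apply/rowP => i; rewrite !mxE. Qed.

Lemma at_heightZ t u x : at_height (u * t) (u *: x) = u *: at_height t x.
Proof. by rewrite /at_height scale_row_mx; congr row_mx; apply/rowP => i; rewrite !mxE. Qed.

Lemma at_height0 : at_height 0 0 = 0.
Proof. by rewrite -row_mx0; congr row_mx; apply/rowP => i; rewrite !mxE. Qed.

Lemma mul_lift_mx c : c *m A = at_height (\sum_i c 0 i) (c *m V).
Proof.
rewrite mul_mx_row; congr row_mx; apply/rowP => i; rewrite !mxE.
by apply: eq_bigr => j _; rewrite mxE mulr1.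
Qed.

Lemma at_height_inj t u x y : at_height t x = at_height u y -> t = u /\ x = y.
Proof.
by move/eq_row_mx => [-> /rowP/(_ 0)]; rewrite !mxE.
Qed.

Lemma in_coneD z z' : in_cone A z -> in_cone A z' -> in_cone A (z + z').
Proof.
move=> [c c0 <-] [c' c0' <-]; exists (c + c'); last by rewrite mulmxDl.
by move=> i; rewrite mxE addr_ge0.
Qed.

Lemma in_coneZ t z : 0 <= t -> in_cone A z -> in_cone A (t *: z).
Proof.
move=> t0 [c c0 <-]; exists (t *: c); last by rewrite scalemxAl.
by move=> i; rewrite mxE mulr_ge0.
Qed.

Lemma in_open_coneZ t z : 0 < t -> in_open_cone A z -> in_open_cone A (t *: z).
Proof.
move=> t0 [c c0 <-]; exists (t *: c); last by rewrite scalemxAl.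
by move=> i; rewrite mxE mulr_gt0.
Qed.

Lemma in_open_coneD z z' : in_open_cone A z -> in_cone A z' -> in_open_cone A (z + z').
Proof.
move=> [c c0 <-] [c' c0' <-]; exists (c + c'); last by rewrite mulmxDl.
by move=> i; rewrite mxE ltr_wpDr.
Qed.

Lemma in_open_coneW z : in_open_cone A z -> in_cone A z.
Proof. by case=> c c0 <-; exists c => // i; exact/ltW/c0. Qed.

Lemma in_cone_row i : in_cone A (at_height 1 (row i V)).
Proof.
exists (delta_mx 0 i) => [j|]; first by rewrite mxE ler0n.
rewrite -rowE row_row_mx /at_height; congr row_mx.
by apply/rowP => j; rewrite !mxE.
Qed.

Lemma in_cone_ge0 t x : in_cone A (at_height t x) -> 0 <= t.
Proof.
case=> c c_ge0; rewrite mul_lift_mx => /at_height_inj[<- _].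
by apply: sumr_ge0 => i _.
Qed.

Lemma in_cone_height0 x : in_cone A (at_height 0 x) -> x = 0.
Proof.
case=> c c_ge0; rewrite mul_lift_mx => /at_height_inj[s0 <-].
move/eqP: s0; rewrite psumr_eq0 // => /allP c0; rewrite (_ : c = 0) ?mul0mx //.
apply/rowP => i; rewrite mxE; apply/eqP.
exact: (implyP (c0 i (mem_index_enum i))).
Qed.

Lemma convex_setP (C : set 'rV[R]_n) : convex_set C <->
  forall x y t, 0 <= t -> t <= 1 -> C x -> C y -> C (t *: x + (1 - t) *: y).
Proof.
split=> [cC x y t t0 t1 Cx Cy|cC x y t /set_mem Cx /set_mem Cy].
  by have /set_mem := cC x y (Itv01 t0 t1) (mem_set Cx) (mem_set Cy).
by apply: mem_set; apply: cC => //; rewrite ?ge0 ?le1.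
Qed.

Lemma lattice_hullE x : lattice_hull x <-> in_cone A (at_height 1 x).
Proof.
split=> [|[c c_ge0]].
  move=> /(_ [set y | in_cone A (at_height 1 y)]); apply.
  split=> [|_ [i _ <-]]; last exact: in_cone_row.
  apply/convex_setP => y z t t0 t1 yA zA.
  rewrite /=; have -> : at_height 1 (t *: y + (1 - t) *: z) = t *: at_height 1 y + (1 - t) *: at_height 1 z.
    by rewrite -!at_heightZ -at_heightD; congr at_height; ring.
  by apply: in_coneD; apply: in_coneZ => //; rewrite subr_ge0.
rewrite mul_lift_mx => /at_height_inj[c1 <-] C [/convex_setP convC VC].
have {}VC i : C (row i V) by apply: VC; exists i.
(* The rows are absorbed one at a time, each partial sum being divided by the weight used so far. *)
suff H (r : seq 'I_m) (s := \sum_(i <- r) c 0 i) : 0 < s ->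
    C (s^-1 *: \sum_(i <- r) c 0 i *: row i V).
  by have /= := H (index_enum 'I_m); rewrite c1 invr1 scale1r -mulmx_sum_row; apply.
rewrite {}/s; elim: r => [|i r IH]; first by rewrite big_nil ltxx.
rewrite !big_cons; set s := \sum_(j <- r) _ in IH *.
have s_ge0 : 0 <= s by rewrite sumr_ge0.
move: (s_ge0); rewrite le_eqVlt => /predU1P[s0|s_gt0].
  rewrite -s0 addr0 => ci; rewrite big1_seq ?addr0 => [|j /andP[_ jr]].
    by rewrite scalerA mulVf ?scale1r ?gt_eqF.
  move/esym/eqP: s0; rewrite psumr_eq0 // => /allP/(_ _ jr)/eqP->.
  by rewrite scale0r.
move=> cs; have cs0 := lt0r_neq0 cs.
have -> : (c 0 i + s)^-1 *: (c 0 i *: row i V + \sum_(j <- r) c 0 j *: row j V) =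
    (c 0 i / (c 0 i + s)) *: row i V +
    (1 - c 0 i / (c 0 i + s)) *: (s^-1 *: \sum_(j <- r) c 0 j *: row j V).
  rewrite scalerDr !scalerA; congr (_ *: _ + _ *: _); first by rewrite mulrC.
  by field; rewrite cs0 gt_eqF.
apply: convC => //; last exact: IH.
  by rewrite divr_ge0 // ltW.
by rewrite ler_pdivrMr // mul1r lerDl.
Qed.

Lemma lattice_hull_row i : P (row i V).
Proof. by apply/lattice_hullE/in_cone_row. Qed.

Lemma dilate_hullE (t : nat) x : dilate t P x <-> in_cone A (at_height t%:R x).
Proof.
split=> [[y /lattice_hullE yP <-]|].
  by rewrite -[X in at_height X]mulr1 at_heightZ; exact: in_coneZ.
(* For [t = 0] the dilate contains the origin because [0 < m] gives a point of the hull. *)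
case: t => [/in_cone_height0 ->|t xP].
  by exists (row (Ordinal m_gt0) V); [exact: lattice_hull_row|rewrite scale0r].
exists (t.+1%:R^-1 *: x); last by rewrite scalerA mulfV ?scale1r ?pnatr_eq0.
apply/lattice_hullE; rewrite -[X in at_height X](@mulVf _ t.+1%:R) ?pnatr_eq0 //.
by rewrite at_heightZ; apply: in_coneZ; rewrite ?invr_ge0.
Qed.

Lemma affine_hull_submx x : affine_hull P x -> (at_height 1 x <= A)%MS.
Proof.
case=> k [y [c [yP c1 ->]]].
have -> : at_height 1 (\sum_j c j *: y j) = \sum_j c j *: at_height 1 (y j).
  rewrite -[X in at_height X (\sum_j _)]c1.
  apply: (big_rec3 (fun a b z => at_height a b = z)) => [|j a b z _ <-].
    by rewrite at_height0.
  by rewrite at_heightD -at_heightZ mulr1.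
apply: summx_sub => j _; apply: scalemx_sub.
exact/in_cone_submx/lattice_hullE.
Qed.

Lemma sub_affine_hull (C : set 'rV[R]_n) x : C x -> affine_hull C x.
Proof.
move=> Cx; exists 1%N, (fun=> x), (fun=> 1).
by split=> //; rewrite big_ord1 // scale1r.
Qed.

Lemma submx_affine_hull x : (at_height 1 x <= A)%MS -> affine_hull P x.
Proof.
case/submxP => c; rewrite mul_lift_mx => /at_height_inj[c1 ->].
exists m, (fun i => row i V), (fun i => c 0 i); split=> //.
  by move=> j; exact: lattice_hull_row.
by rewrite mulmx_sum_row.
Qed.

(** From left to right, the segment from the barycentre [g] of the generators to [x] is prolonged
    inside the hull, so [x] is a positive combination of [g] and a hull point. Conversely, positive
    coefficients survive small displacements within the affine hull. *)
Lemma relint_hullE x : relint P x <-> in_open_cone A (at_height 1 x).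
Proof.
split=> [xP|[c c_gt0]].
  have Px : P x by apply: interior_subset xP.
  have : within (affine_hull P) (nbhs x) P.
    by rewrite (nbhs_subspace_in (sub_affine_hull Px)); exact: xP.
  move=> /nbhs_ballP[e /= e_gt0 eP].
  pose u : 'rV[R]_m := const_mx (m%:R^-1).
  have u1 : \sum_i u 0 i = 1.
    rewrite (eq_bigr (fun=> m%:R^-1)) => [|i _]; last by rewrite mxE.
    by rewrite sumr_const card_ord -[LHS]mulr_natr mulVf // pnatr_eq0 -lt0n.
  have u_gt0 i : 0 < u 0 i by rewrite mxE invr_gt0 ltr0n.
  pose g := u *m V.
  (* Chosen so that [d *: (x - g)] has sup norm below [e]. *)
  pose d := e / (1 + \sum_j `|(x - g) 0 j|).
  have s_gt0 : 0 < 1 + \sum_j `|(x - g) 0 j| by rewrite ltr_wpDr // sumr_ge0.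
  have d_gt0 : 0 < d by rewrite divr_gt0.
  have Pg : P g.
    by apply/lattice_hullE; exists u; [move=> i; exact/ltW|rewrite mul_lift_mx u1].
  have /eP Py : ball x e (x + d *: (x - g)).
    split=> // i j; rewrite /ball /= ord1 mxE opprD addrA subrr sub0r normrN mxE.
    rewrite normrM gtr0_norm // mulrAC ltr_pdivrMr // ltr_pM2l //.
    by rewrite ltr_pwDl // (bigD1 j) //= lerDl sumr_ge0.
  have {Py}/lattice_hullE Py : P (x + d *: (x - g)).
    apply: Py; apply: submx_affine_hull.
    have -> : at_height 1 (x + d *: (x - g)) =
        (1 + d) *: at_height 1 x - d *: at_height 1 g.
      rewrite -scaleNr -!at_heightZ -at_heightD; congr at_height; first by ring.
      by rewrite scalerBr scalerDl scale1r addrA scaleNr.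
    by rewrite addmx_sub ?eqmx_opp ?scalemx_sub //; exact/in_cone_submx/lattice_hullE.
  have -> : at_height 1 x = (1 + d)^-1 *: (d *: at_height 1 g + at_height 1 (x + d *: (x - g))).
    rewrite -!at_heightZ -at_heightD -at_heightZ; congr at_height.
      by field; rewrite gt_eqF // addr_gt0.
    rewrite addrCA -scalerDr [g + _]addrC subrK -{2}[x]scale1r -scalerDl scalerA.
    by rewrite mulVf ?scale1r // gt_eqF // addr_gt0.
  apply: in_open_coneZ; first by rewrite invr_gt0 addr_gt0.
  apply: in_open_coneD => //; apply: in_open_coneZ => //.
  by exists u => //; rewrite mul_lift_mx u1.
rewrite mul_lift_mx => /at_height_inj[c1 cx].
have Px : P x.
  by apply/lattice_hullE; exists c; [move=> i; exact/ltW|rewrite mul_lift_mx c1 cx].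
suff : within (affine_hull P) (nbhs x) P.
  by rewrite (nbhs_subspace_in (sub_affine_hull Px)).
(* [M] writes a displacement in terms of the generators and [K] bounds the growth; within radius
   [e / (1 + K)] the new coefficients stay below every [c 0 i]. *)
pose M := pinvmx A; pose K := \sum_j \sum_i `|M j i|.
have K_gt0 : 0 < 1 + K by rewrite ltr_wpDr // sumr_ge0 // => j _; rewrite sumr_ge0.
have [e e_gt0 eP] := ltr_bigmin c_gt0.
apply/nbhs_ballP; exists (e / (1 + K)) => /=; first by rewrite divr_gt0.
move=> y xy /affine_hull_submx yA; apply/lattice_hullE.
pose f := at_height 0 (y - x) *m M.
have fA : f *m A = at_height 0 (y - x).
  rewrite /f mulmxKpV // -(subrr 1).
  have -> : at_height (1 - 1) (y - x) = at_height 1 y - at_height 1 x.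
    by rewrite -[- at_height _ _]scaleN1r -at_heightZ -at_heightD mulN1r scaleN1r.
  by rewrite addmx_sub ?eqmx_opp //; exact/in_cone_submx/lattice_hullE.
exists (c + f); last first.
  by rewrite mulmxDl fA mul_lift_mx -at_heightD c1 cx addr0 addrC subrK.
move=> i; rewrite mxE -(opprK (f 0 i)) subr_ge0.
apply: le_trans (ler_norm _) (le_trans _ (ltW (eP i))); rewrite normrN.
have zle j : `|at_height 0 (y - x) 0 j| <= e / (1 + K).
  case: (split_ordP j) => k ->; last by rewrite row_mxEr mxE normr0 divr_ge0 // ltW.
  rewrite row_mxEl mxE [in X in _ + X]mxE -normrN opprB; apply: ltW.
  exact: (xy.2 0 k).
rewrite mxE; apply: le_trans (ler_norm_sum _ _ _) _.
apply: (@le_trans _ _ (\sum_j e / (1 + K) * `|M j i|)).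
  by apply: ler_sum => j _; rewrite normrM ler_wpM2r.
rewrite -mulr_sumr mulrAC ler_pdivrMr // ler_pM2l //.
apply: (@le_trans _ _ K); last by rewrite lerDr.
by apply: ler_sum => j _; rewrite (bigD1 i) //= lerDl sumr_ge0.
Qed.

Lemma dilate_relint_hullE (t : nat) x : (0 < t)%N ->
  dilate t (relint P) x <-> in_open_cone A (at_height t%:R x).
Proof.
move=> t_gt0; split=> [[y /relint_hullE yP <-]|xP].
  by rewrite -[X in at_height X]mulr1 at_heightZ; apply: in_open_coneZ; rewrite ?ltr0n.
have t0 : t%:R != 0 :> R by rewrite pnatr_eq0 -lt0n.
exists (t%:R^-1 *: x); last by rewrite scalerA mulfV ?scale1r.
apply/relint_hullE; rewrite -[X in at_height X](@mulVf _ t%:R) //.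
by rewrite at_heightZ; apply: in_open_coneZ; rewrite ?invr_gt0 ?ltr0n.
Qed.

(* A left null vector [v] of [C - t] exists since the row sums of [C] are [t];
   then [t |v| <= |v| C] entrywise, with equality because both sides have the
   same sum, so [|v|] is stationary. *)
Lemma ex_stationary (C : 'M[R]_m) t :
  (forall k l, 0 <= C k l) -> (forall k, \sum_l C k l = t) ->
  exists c : 'rV[R]_m, [/\ forall i, 0 <= c 0 i, \sum_i c 0 i = 1 & c *m C = t *: c].
Proof.
move=> C_ge0 Ct.
have /det0P[v v0 /eqP] : \det (C - t%:M) == 0.
  rewrite -det_tr; apply/det0P; exists (const_mx 1).
    apply/eqP => /rowP/(_ (Ordinal m_gt0)); rewrite !mxE => /eqP.
    by rewrite oner_eq0.
  rewrite linearB /= tr_scalar_mx mulmxBr; apply/eqP; rewrite subr_eq0; apply/eqP.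
  apply/rowP => k; rewrite mul_mx_scalar !mxE mulr1 -(Ct k).
  by apply: eq_bigr => l _; rewrite !mxE mul1r.
rewrite mulmxBr subr_eq0 mul_mx_scalar => /eqP/rowP vC.
pose c : 'rV[R]_m := \row_i `|v 0 i|.
have c_le l : 0 <= (c *m C) 0 l - t * c 0 l.
  rewrite subr_ge0; have -> : t * c 0 l = `|(v *m C) 0 l|.
    have t_ge0 : 0 <= t by rewrite -(Ct l) sumr_ge0.
    by rewrite vC !mxE normrM ger0_norm.
  rewrite !mxE; apply: le_trans (ler_norm_sum _ _ _) _.
  by apply: ler_sum => k _; rewrite mxE normrM (ger0_norm (C_ge0 k l)).
have cC : c *m C = t *: c.
  have : \sum_l ((c *m C) 0 l - t * c 0 l) = 0.
    rewrite sumrB -mulr_sumr; apply/eqP; rewrite subr_eq0; apply/eqP.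
    under eq_bigr do rewrite mxE.
    rewrite exchange_big mulr_sumr; apply: eq_bigr => k _.
    by rewrite -mulr_sumr Ct mulrC.
  move/eqP; rewrite psumr_eq0 // => /allP cC0; apply/rowP => l.
  by have := implyP (cC0 l (mem_index_enum l)) isT; rewrite subr_eq0 [RHS]mxE => /eqP.
have c_ge0 i : 0 <= c 0 i by rewrite mxE.
have s_gt0 : 0 < \sum_i c 0 i.
  have /rV0Pn[i vi] := v0; rewrite (bigD1 i) //= ltr_pwDl ?sumr_ge0 //.
  by rewrite mxE normr_gt0.
exists ((\sum_i c 0 i)^-1 *: c); split.
- by move=> i; rewrite mxE mulr_ge0 // invr_ge0 ltW.
- by under eq_bigr do rewrite mxE; rewrite -mulr_sumr mulVf ?gt_eqF.
by rewrite -scalemxAl cC !scalerA mulrC.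
Qed.

Definition shift_dilate (i : nat) z : set 'rV[R]_n := [set x + z | x in dilate i P].

Lemma shift_dilate_row i z k : shift_dilate i z (i%:R *: row k V + z).
Proof. by exists (i%:R *: row k V) => //; exists (row k V) => //; exact: lattice_hull_row. Qed.

Lemma shift_dilate_matrix (Q : R -> Prop) i z t :
  (forall k, exists2 c : 'rV[R]_m, (forall j, Q (c 0 j)) &
    c *m A = at_height t (i%:R *: row k V + z)) ->
  exists C : 'M[R]_m, [/\ forall k l, Q (C k l), forall k, \sum_l C k l = t &
    forall k, row k C *m V = i%:R *: row k V + z].
Proof.
move=> ik; have /choice[f fP] : forall k, exists c : 'rV[R]_m, (forall j, Q (c 0 j)) /\
    c *m A = at_height t (i%:R *: row k V + z).
  by move=> k; have [c] := ik k; exists c.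
exists (\matrix_k f k); split=> k => [l||].
- by rewrite mxE; case: (fP k).
- have [_] := fP k; rewrite mul_lift_mx => /at_height_inj[<- _].
  by apply: eq_bigr => l _; rewrite mxE.
have [_] := fP k; rewrite mul_lift_mx => /at_height_inj[_ <-].
by rewrite rowK.
Qed.

(** Averaging the relations with the stationary [c] turns them into [t *: p = i%:R *: p + z] for the
    single point [p = c *m V]. *)
Lemma shift_dilate_factor (C : 'M[R]_m) (i : nat) z t :
  (forall k l, 0 <= C k l) -> (forall k, \sum_l C k l = t) ->
  (forall k, row k C *m V = i%:R *: row k V + z) ->
  exists c : 'rV[R]_m, [/\ forall i, 0 <= c 0 i, \sum_i c 0 i = 1, c *m C = t *: c &
    at_height (t - i%:R) z = (t - i%:R) *: at_height 1 (c *m V)].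
Proof.
move=> C_ge0 Ct CV; have [c [c_ge0 c1 cC]] := ex_stationary C_ge0 Ct.
exists c; split=> //; rewrite -at_heightZ mulr1; congr at_height.
have : c *m (C *m V) = i%:R *: (c *m V) + z.
  rewrite mulmx_sum_row [c *m V]mulmx_sum_row.
  under eq_bigr do rewrite row_mul CV scalerDr scalerA mulrC -scalerA.
  by rewrite big_split /= -scaler_sumr -scaler_suml c1 scale1r.
rewrite mulmxA cC -scalemxAl scalerBl => ->.
by rewrite addrC addKr.
Qed.

Hypothesis S_nonconst : exists k l, row k S != row l S.

Lemma ex_width : exists (j : 'I_n) (k l : 'I_m),
  [/\ V l j < V k j, forall h, V h j <= V k j & forall h, V l j <= V h j].
Proof.
have [k0 [l0 /rV0Pn]] : exists k l, row k S - row l S != 0.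
  by have [k [l kl]] := S_nonconst; exists k, l; rewrite subr_eq0.
move=> [j]; rewrite !mxE subr_eq0 => kl; exists j.
have [k _ kmax] := @arg_maxP _ _ _ k0 xpredT (fun h => V h j) isT.
have [l _ lmin] := @arg_minP _ _ _ k0 xpredT (fun h => V h j) isT.
exists k, l; split=> [|h|h]; [|exact: kmax|exact: lmin].
have Vkl : V k0 j != V l0 j by rewrite !mxE eqr_int.
rewrite ltNge; apply: contra_neqN Vkl => kl'.
have E h : V h j = V l j.
  by apply/le_anti; rewrite (le_trans (kmax h isT) kl') lmin.
by rewrite !E.
Qed.

(** Compare coordinate [j] at a highest generator [k] and a lowest one [l]: subtracting the two
    bounds gives [i] times the width at most [t] times the width. It is strict if generator [l] has
    positive weight in row [k]. *)
Lemma shift_dilate_width (C : 'M[R]_m) (i : nat) z t :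
  (forall k l, 0 <= C k l) -> (forall k, \sum_l C k l = t) ->
  (forall k, row k C *m V = i%:R *: row k V + z) ->
  i%:R <= t /\ ((forall k l, 0 < C k l) -> i%:R < t).
Proof.
move=> C_ge0 Ct CV; have [j [k [l [lk kmax lmin]]]] := ex_width.
have E h : \sum_g C h g * V g j = i%:R * V h j + z 0 j.
  have /rowP/(_ j) := CV h; rewrite mxE => E; rewrite -[RHS]/(i%:R * V h j + z 0 j).
  transitivity (\sum_g row h C 0 g * V g j); last by rewrite E !mxE.
  by apply: eq_bigr => g _; rewrite !mxE.
have sk h : t * V h j = \sum_g C k g * V h j by rewrite -mulr_suml Ct.
have sl h : t * V h j = \sum_g C l g * V h j by rewrite -mulr_suml Ct.
have lo : t * V l j <= i%:R * V l j + z 0 j.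
  by rewrite -E sl; apply: ler_sum => g _; rewrite ler_wpM2l.
split=> [|C_gt0].
  have up : i%:R * V k j + z 0 j <= t * V k j.
    by rewrite -E sk; apply: ler_sum => g _; rewrite ler_wpM2l.
  rewrite -(ler_pM2r (_ : 0 < V k j - V l j)) ?subr_gt0 // !mulrBr; lra.
have up : i%:R * V k j + z 0 j < t * V k j.
  rewrite -E sk (bigD1 l) //= [ltRHS](bigD1 l) //= ltr_leD ?ltr_pM2l //.
  by apply: ler_sum => g _; rewrite ler_wpM2l.
rewrite -(ltr_pM2r (_ : 0 < V k j - V l j)) ?subr_gt0 // !mulrBr; lra.
Qed.

Lemma shift_dilate_sub (i t : nat) z :
  shift_dilate i z `<=` dilate t P <-> in_cone A (at_height (t%:R - i%:R) z).
Proof.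
split=> [iP|zA x [y /dilate_hullE yA <-]]; last first.
  by apply/dilate_hullE; rewrite -(subrKC i%:R t%:R) at_heightD; exact: in_coneD.
have [k|C [C_ge0 Ct CV]] := @shift_dilate_matrix (fun u => 0 <= u) i z t%:R.
  by have /iP/dilate_hullE := shift_dilate_row i z k.
have [c [c_ge0 c1 _ ->]] := shift_dilate_factor C_ge0 Ct CV.
apply: in_coneZ; first by rewrite subr_ge0 (shift_dilate_width C_ge0 Ct CV).1.
by exists c; rewrite ?mul_lift_mx ?c1.
Qed.

Lemma shift_dilate_sub_relint (i t : nat) z : (0 < t)%N ->
  shift_dilate i z `<=` dilate t (relint P) <->
  in_open_cone A (at_height (t%:R - i%:R) z).
Proof.
move=> t_gt0; split=> [iP|zA x [y /dilate_hullE yA <-]]; last first.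
  apply/dilate_relint_hullE => //; rewrite -(subrKC i%:R t%:R).
  by rewrite [i%:R + _]addrC [y + z]addrC at_heightD; exact: in_open_coneD.
have [k|C [C_gt0 Ct CV]] := @shift_dilate_matrix (fun u => 0 < u) i z t%:R.
  by have /iP/(dilate_relint_hullE _ t_gt0) := shift_dilate_row i z k.
have C_ge0 k l := ltW (C_gt0 k l).
have [c [c_ge0 c1 cC ->]] := shift_dilate_factor C_ge0 Ct CV.
apply: in_open_coneZ.
  by rewrite subr_gt0; exact: (shift_dilate_width C_ge0 Ct CV).2.
exists c; last by rewrite mul_lift_mx c1.
(* By stationarity [t * c 0 l] is the sum of the [c 0 k * C k l], with all [C k l] positive and some
   [c 0 k] positive. *)
move=> l; rewrite -(pmulr_rgt0 _ (_ : 0 < t%:R)) ?ltr0n //.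
have /rowP/(_ l) := cC; rewrite [RHS]mxE => <-; rewrite mxE.
have [k ck] : exists k, 0 < c 0 k.
  apply: contrapT => /forallNP c0; have := @ltr01 R; rewrite -c1 ltNge.
  by case/negP; apply: sumr_le0 => k _; rewrite leNgt; apply/negP/c0.
rewrite (bigD1 k) //= ltr_pwDl ?mulr_gt0 // sumr_ge0 // => h _.
by rewrite mulr_ge0.
Qed.

End Geometry.

(** * Counting gigantures *)

Section GigantureCount.
Variables (R : realType) (n m : nat) (S : 'M[int]_(m, n)).
Hypothesis m_gt0 : (0 < m)%N.
Local Notation A := (lift_mx R S).
Local Notation V := (map_mx intr S : 'M[R]_(m, n)).
Local Notation P := (@lattice_hull R n m S).

Lemma lattice_countE t : lattice_count P t = count_points (in_cone A) t%:Z.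
Proof.
congr card_set; apply/seteqP; split=> a /=; first by move/dilate_hullE; exact.
by move=> aA; apply/dilate_hullE.
Qed.

Lemma count_points_lt0 (K : set 'rV[R]_(n + 1)) t :
  (forall x, K x -> in_cone A x) -> t < 0 -> count_points K t = 0%N.
Proof.
move=> KA t0; apply: card_set0 => a /= /KA /in_cone_height.
by rewrite leNgt t0.
Qed.

(** The cone has no negative heights, so only [i <= t] occurs; reversing the sum replaces height
    [t - i] by [i]. *)
Lemma count_pairs (K : set 'rV[R]_(n + 1)) (t : nat) :
  (forall x, K x -> in_cone A x) ->
  finite_set [set p : nat * 'rV[int]_n | K (point R (t%:Z - p.1%:Z) p.2)] /\
  card_set [set p : nat * 'rV[int]_n | K (point R (t%:Z - p.1%:Z) p.2)] =
  (\sum_(i < t.+1) count_points K i%:Z)%N.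
Proof.
move=> KA.
have finK u : finite_set [set a | K (point R u a)].
  by apply: sub_finite_set (finite_cone R S u) => a /KA.
pose F (i : 'I_t.+1) := [set (val i, a) | a in [set a | K (point R (t%:Z - i%:Z) a)]].
have KF p : [set p : nat * 'rV[int]_n | K (point R (t%:Z - p.1%:Z) p.2)] p <->
    exists2 i, xpredT i & F i p.
  split=> [/= Kp|[i _ [a Ka <-]]//].
  have it : (p.1 < t.+1)%N.
    by have := in_cone_height (KA _ Kp); rewrite subr_ge0 lez_nat ltnS.
  by exists (Ordinal it) => //; exists p.2 => //=; rewrite -surjective_pairing.
have finF : finite_set [set p : nat * 'rV[int]_n | K (point R (t%:Z - p.1%:Z) p.2)].
  apply: (@sub_finite_set _ _ (\bigcup_(i in [set: 'I_t.+1]) F i)).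
    by move=> p /KF[i _ Fp]; exists i.
  apply: bigcup_finite; first exact: finite_finset.
  by move=> i _; exact/finite_image/finK.
split=> //; rewrite (@card_set_sum _ _ xpredT F) //.
  rewrite (reindex_inj rev_ord_inj) /=; apply: eq_bigr => i _.
  rewrite card_set_image => [|a b []//|]; last exact: finK.
  have -> : t%:Z - (rev_ord i)%:Z = i%:Z by rewrite /=; have := ltn_ord i; lia.
  by [].
by move=> p i j _ _ [a _ <-] [b _ [ij _]]; apply: val_inj.
Qed.

Lemma lattice_vecB (a b : 'rV[int]_n) :
  lattice_vec R (a - b) = lattice_vec R a - lattice_vec R b.
Proof. exact: map_mxB. Qed.

Lemma at_height_point (t i : nat) (a : 'rV[int]_n) :
  at_height (t%:R - i%:R) (lattice_vec R a) = point R (t%:Z - i%:Z) a.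
Proof.
by rewrite /at_height /point; congr row_mx; apply/rowP => j; rewrite !mxE rmorphB.
Qed.

Hypothesis S_nonconst : exists k l, row k S != row l S.

Definition giganture (p : nat * 'rV[int]_n) : set 'rV[R]_n :=
  translate (dilate p.1 P) p.2.

(** Equal gigantures contain each other, so the difference of the data lies in the cone with both
    signs of the height; at height 0 the cone is only the origin. *)
Lemma giganture_inj : injective giganture.
Proof.
have sub p q : giganture p = giganture q ->
    in_cone A (at_height (q.1%:R - p.1%:R) (lattice_vec R (p.2 - q.2))).
  move=> pq; apply/shift_dilate_sub => // x [y yP <-].
  have : giganture q (y + lattice_vec R p.2) by rewrite -pq; exists y.
  case=> z zP /eqP; rewrite -subr_eq => /eqP <-.
  by rewrite lattice_vecB addrA subrK addrK.
move=> [i a] [j b] /[dup] /sub /= ab /esym /sub /= ba.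
have ij : i = j.
  apply/eqP; rewrite -(eqr_nat R) eq_le -[_ <= j%:R]subr_ge0 -[_ <= i%:R]subr_ge0.
  by rewrite (in_cone_ge0 ab) (in_cone_ge0 ba).
move: ab; rewrite ij subrr => /in_cone_height0; rewrite lattice_vecB.
move/eqP; rewrite subr_eq0 => /eqP/rowP ab; congr (_, _).
by apply/rowP => k; have := ab k; rewrite !mxE => /intr_inj.
Qed.

Lemma giganture_countE t :
  giganture_count P t = (\sum_(i < t.+1) count_points (in_cone A) i%:Z)%N.
Proof.
have [fin <-] := @count_pairs (in_cone A) t (fun x => id).
rewrite -(card_set_image giganture_inj) //.
congr card_set; apply/seteqP; split=> G /=.
  move=> [[i [a ->]] aP]; exists (i, a) => //=.
  by rewrite -at_height_point; apply/shift_dilate_sub.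
move=> [[i a] /= aA <-]; split; first by exists i, a.
by apply/shift_dilate_sub => //; rewrite at_height_point.
Qed.

Lemma giganture_count_relintE t : (0 < t)%N ->
  giganture_count_relint P t = (\sum_(i < t.+1) count_points (in_open_cone A) i%:Z)%N.
Proof.
move=> t_gt0.
have [fin <-] := @count_pairs (in_open_cone A) t (@in_open_coneW _ _ _ _).
rewrite -(card_set_image giganture_inj) //.
congr card_set; apply/seteqP; split=> G /=.
  move=> [[i [a ->]] aP]; exists (i, a) => //=.
  by rewrite -at_height_point; apply/shift_dilate_sub_relint.
move=> [[i a] /= aA <-]; split; first by exists i, a.
by apply/shift_dilate_sub_relint => //; rewrite at_height_point.
Qed.

(** Makes the partial sum at [t = 0] agree with the value 0 prescribed by [se_relint_coef]. *)
Lemma count_open_cone0 : count_points (in_open_cone A) 0 = 0%N.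
Proof.
apply: card_set0 => a /= [c c_gt0 /sum_coef_point].
apply/eqP; rewrite gt_eqF // (bigD1 (Ordinal m_gt0)) //= ltr_pwDl ?sumr_ge0 // => i _.
exact: ltW.
Qed.

End GigantureCount.

(** * Dimension of the polytope and rank of the lifted matrix *)

Section Dimension.
Variables (R : realType) (n m : nat) (S : 'M[int]_(m, n)).
Local Notation A := (lift_mx R S).
Local Notation V := (map_mx intr S : 'M[R]_(m, n)).
Local Notation P := (@lattice_hull R n m S).

(** The span of the cone has as a basis a lifted base point of the affine hull together with a basis
    of its direction space at height 0. *)
Lemma rank_lift_mx d : (0 < m)%N -> has_dim P d -> \rank A = d.+1.
Proof.
move=> m_gt0 [p [U [<- affE]]].
pose X := vbasis U.
pose W : 'M[R]_(\dim U, n) := \matrix_i X`_i.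
pose B : 'M[R]_(1 + \dim U, n + 1) := col_mx (at_height 1 p) (row_mx W 0).
have affP u : u \in U -> affine_hull P (p + u) by rewrite affE => uU; exists u.
have mulWE (c : 'rV_(\dim U)) : c *m W = \sum_i c 0 i *: X`_i.
  by rewrite mulmx_sum_row; apply: eq_bigr => i _; rewrite rowK.
have mulBE (a : 'rV_1) c : row_mx a c *m B = at_height (a 0 0) (a 0 0 *: p + c *m W).
  rewrite mul_row_col [a in a *m _]mx11_scalar mul_scalar_mx mul_mx_row mulmx0.
  rewrite -at_heightZ mulr1 /at_height add_row_mx addr0 //.
have freeB : row_free B.
  apply: inj_row_free => v; rewrite -[v]hsubmxK mulBE -(at_height0 R n).
  move=> /at_height_inj[a0]; rewrite a0 scale0r add0r mulWE => c0.
  rewrite [lsubmx v]mx11_scalar a0 raddf0.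
  have /freeP/(_ (fun i => rsubmx v 0 i) c0) vr0 := basis_free (vbasisP U).
  rewrite (_ : rsubmx v = 0) ?row_mx0 //; apply/rowP => i.
  by rewrite vr0 mxE.
have AB : (A :=: B)%MS.
  apply/eqmxP; apply/andP; split; apply/row_subP => i.
    have : affine_hull P (row i V) by apply: sub_affine_hull; exact: lattice_hull_row.
    rewrite affE => -[u /= uU uE].
    have -> : row i A = row_mx 1%:M (\row_j coord X j u) *m B.
      rewrite mulBE mxE eqxx mulr1n scale1r mulWE.
      under eq_bigr do rewrite mxE.
      rewrite -coord_vbasis // uE row_row_mx; congr row_mx.
      by apply/rowP => j; rewrite !mxE.
    exact: submxMl.
  case: (split_ordP i) => j ->.
    rewrite rowKu ord1 row_id -[p]addr0.
    by apply: affine_hull_submx; apply: affP; exact: mem0v.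
  rewrite rowKd row_row_mx row0 rowK.
  have -> : row_mx X`_j 0 = at_height 1 (p + X`_j) - at_height 1 (p + 0) :> 'rV[R]_(n + 1).
    rewrite /at_height opp_row_mx add_row_mx addr0 addrC addKr subrr //.
  have jU : X`_j \in U by apply: vbasis_mem; rewrite mem_nth // size_tuple.
  by rewrite addmx_sub ?eqmx_opp //; apply: affine_hull_submx; apply: affP => //; exact: mem0v.
by rewrite AB (eqP freeB).
Qed.

Lemma rank_nonconst : (1 < \rank A)%N -> exists k l, row k S != row l S.
Proof.
move=> rA; apply: contrapT => /forallNP Sconst; move: rA.
rewrite ltnNge => /negP; apply.
case: (posnP m) => [m0|m_gt0]; first by rewrite (leq_trans (rank_leq_row A)) // m0.
pose k := Ordinal m_gt0.
have -> : A = const_mx 1 *m row k A.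
  apply/row_matrixP => i; rewrite row_mul row_const.
  have -> : const_mx 1 = 1%:M :> 'M[R]_1 by apply/matrixP => ? ?; rewrite !ord1 !mxE.
  rewrite mul1mx !row_lift_mx; congr point.
  have /forallNP/(_ i)/negP := Sconst k.
  by rewrite negbK => /eqP.
by rewrite (leq_trans (mxrankM_maxl _ _)) // rank_leq_col.
Qed.

End Dimension.

Lemma lattice_polytope_matrix (R : realType) n (P : set 'rV[R]_n) :
  lattice_polytope P ->
  exists m (S : 'M[int]_(m, n)), (0 < m)%N /\ P = @lattice_hull R n m S.
Proof.
case=> X [/finite_seqP[s ->] [a /= a_s] ->].
exists (size s), (\matrix_(i < size s) s`_i); split; first by case: (s) a_s.
rewrite /lattice_hull; congr conv_hull; apply/seteqP; split=> x.
  move=> [b /= b_s <-]; have bi : (index b s < size s)%N by rewrite index_mem.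
  by exists (Ordinal bi); rewrite // -map_row rowK nth_index.
move=> [i _ <-]; exists s`_i; first exact: mem_nth.
by rewrite -map_row rowK.
Qed.

Lemma convolution_1subX_sum (u : nat -> rat) :
  convolution (1 - 'X) (fun k => \sum_(i < k.+1) u i) =1 u.
Proof.
move=> [|k]; rewrite convolution_1subX; first by rewrite big_ord1 subr0.
by rewrite [X in X - _]big_ord_recr /= [X in X - _]addrC addrK.
Qed.

Section Polytope.
Variables (R : realType) (n d m : nat) (S : 'M[int]_(m, n)).
Local Notation A := (lift_mx R S).
Local Notation P := (@lattice_hull R n m S).
Hypotheses (d_gt0 : (0 < d)%N) (m_gt0 : (0 < m)%N) (dimP : has_dim P d).

(** Here [0 < d] enters: rank at least 2 excludes a single point. *)
Let S_nonconst : exists k l, row k S != row l S.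
Proof. by apply: (@rank_nonconst R); rewrite (rank_lift_mx m_gt0 dimP). Qed.

Lemma ehr_coefE : ehr_coef P = fun k => (count_points (in_cone A) k%:Z)%:R.
Proof. by apply/funext => k; rewrite /ehr_coef lattice_countE. Qed.

Lemma se_coefE : se_coef P = fun k => \sum_(i < k.+1) (count_points (in_cone A) i%:Z)%:R.
Proof. by apply/funext => k; rewrite /se_coef giganture_countE // natr_sum. Qed.

Lemma se_relint_coefE :
  se_relint_coef P = fun k => \sum_(i < k.+1) (count_points (in_open_cone A) i%:Z)%:R.
Proof.
apply/funext => -[|k]; rewrite /se_relint_coef /=.
  by rewrite big_ord1 count_open_cone0.
by rewrite giganture_count_relintE // natr_sum.
Qed.

Lemma hull_reciprocity :
  [/\ is_expansion (Ehr P) (ehr_coef P),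
      is_expansion (SE P) (se_coef P) &
      is_expansion (SE_relint P) (se_relint_coef P)]
  /\ SE_relint P = (-1) ^+ d.+1 / (1 - ratX) * subst_inv (Ehr P)
  /\ (-1) ^+ d.+1 / (1 - ratX) * subst_inv (Ehr P)
     = (-1) ^+ d / ratX * subst_inv (SE P).
Proof.
have [g [coneg openg g0]] := cone_reciprocity R S.
rewrite (rank_lift_mx m_gt0 dimP) in coneg openg g0.
apply: (@series_reciprocity d (fun k => g k%:Z) _
  (fun k => (count_points (in_open_cone A) k%:Z)%:R)) => [k|k||].
- rewrite ehr_coefE.
  rewrite (@convolution_bdiff _ (fun t => (count_points (in_cone A) t)%:R)) => [|t t0].
    by rewrite coneg; case: leqP => // kd; apply: g0; right.
  by rewrite (@count_points_lt0 _ _ _ S).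
- rewrite (@convolution_bdiff _ (fun t => (count_points (in_open_cone A) t)%:R)) => [|t t0].
    rewrite openg; case: leqP => kd; first by rewrite subzn.
    by apply: g0; left; rewrite subr_lt0.
  rewrite (@count_points_lt0 _ _ _ S) // => x; exact: in_open_coneW.
- by rewrite ehr_coefE se_coefE; exact: convolution_1subX_sum.
by rewrite se_relint_coefE; exact: convolution_1subX_sum.
Qed.

End Polytope.

(** The expansion claims accompany the identities because [genfun] falls back to 0 when no rational
    expansion exists. *)
Theorem theorem7 (R : realType) (n d : nat) (P : set 'rV[R]_n)
    (d_gt0 : (0 < d)%N) (d_le_n : (d <= n)%N)
    (polP : lattice_polytope P) (dimP : has_dim P d) :
  [/\ is_expansion (Ehr P) (ehr_coef P),
      is_expansion (SE P) (se_coef P) &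
      is_expansion (SE_relint P) (se_relint_coef P)]
  /\ SE_relint P = (-1) ^+ d.+1 / (1 - ratX) * subst_inv (Ehr P)
  /\ (-1) ^+ d.+1 / (1 - ratX) * subst_inv (Ehr P)
     = (-1) ^+ d / ratX * subst_inv (SE P).
Proof.
have [m [S [m_gt0 PE]]] := lattice_polytope_matrix polP.
by move: dimP; rewrite PE => dimS; exact: hull_reciprocity.
Qed.
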